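(* Let $X$ be a real reflexive Banach space, $P\subset X$ a cone, and $J:X\to\mathbb R$ a locally Lipschitz functional. Suppose that for some $\mu_0\in(0,1)$: (a) $(I-\nabla J)\big(\partial D^{+}(\mu_0)\big)\subset D^{+}(\tfrac12\mu_0)$ and $(I-\nabla J)\big(\partial D^{-}(\mu_0)\big)\subset D^{-}(\tfrac12\mu_0)$; (b) $J$ satisfies the non-smooth $C$-condition on $X$ with respect to $X$, on $D^+(\tfrac34\mu_0)$ with respect to $D^+(\mu_0)$, on $D^-(\tfrac34\mu_0)$ with respect to $D^-(\mu_0)$, and on $D^+(\mu_0)\cap D^-(\mu_0)$ with respect to $D^+(\mu_0)\cap D^-(\mu_0)$. Let $r\in\mathbb R$, let $\mathbb K_r^1=\mathbb K_r\cap(D^+(\mu_0)\cup D^-(\mu_0))$ and $\mathbb K_r^2=\mathbb K_r\setminus(D^+(\mu_0)\cup D^-(\mu_0))$, and let $\delta>0$ be small, such that $(\mathbb K_r^1)_{3\delta}\cap(\mathbb K_r^2)_{3\delta}=\emptyset$. Then for each $\varepsilon_0>0$ there exists $0<\bar\varepsilon<\varepsilon_0$ such that for each $0<\varepsilon<\bar\varepsilon$ and each compact set $A\subset J^{r+\varepsilon}$ there exists $\eta\in C([0,1]\times X,X)$ with the following properties: 1) $\eta(t,u)=u$ if $t=0$ or $u\notin J^{-1}([r-\varepsilon_0,r+\varepsilon_0])\setminus(\mathbb K_r^2)_\delta$; 2) $\eta(1,A\setminus(\mathbb K_r^2)_{3\delta})\subset J^{r-\varepsilon}\cup\operatorname{int}(D^+(\mu_0))\cup\operatorname{int}(D^-(\mu_0))$;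 and $\eta(1,A)\subset J^{r-\varepsilon}\cup\operatorname{int}(D^+(\mu_0))\cup\operatorname{int}(D^-(\mu_0))$ if $\mathbb K_r^2=\emptyset$; 3) $\eta(t,\cdot)$ is a homeomorphism of $X$ for each $t\in[0,1]$; 4) $J(\eta(\cdot,u))$ is non-increasing for every $u\in X$; 5) $\eta(t,D^+(\mu_0))\subset D^+(\mu_0)$, $\eta(t,D^-(\mu_0))\subset D^-(\mu_0)$ and $\eta(t,D^+(\mu_0)\cap D^-(\mu_0))\subset D^+(\mu_0)\cap D^-(\mu_0)$ for $t\in[0,1]$; 6) if $J$ is even, $\eta$ is odd in $u\in X$.
   Context: $X^*$ is the dual of $X$ with norm $\|\cdot\|_*$. A cone $P$ in $X$ is a closed convex set with $\lambda x\in P$ for all $x\in P$, $\lambda\ge0$, and $P\cap(-P)=\{0\}$. For $\mu>0$, $D^{\pm}(\mu)=\{x\in X:\operatorname{dist}(x,\pm P)\le\mu\}$. For a set $D\subset X$, $\partial D$ and $\operatorname{int}D$ denote boundary and interior; $\partial J(x)\subset X^*$ is the Clarke generalized subdifferential of $J$ at $x$. The duality map $\mathscr F:X^*\to2^X$ is $\mathscr F(x^* )=\{x\in X:\langle x^*,x\rangle=\|x^*\|_*^2=\|x\|^2\}$, and $\nabla J(x):=\mathscr F(\partial J(x))=\bigcup_{x^*\in\partial J(x)}\mathscr F(x^* )$. $I$ is the identity; $(I-\nabla J)(A)\subset B$ means $x-y\in B$ for all $x\in A$, $y\in\nabla J(x)$. For a nonempty closed convex $D\subset X$ and $x\in D$,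 $m_D(x)=\inf_{x^*\in\partial J(x)}\sup\{\langle x^*,x-y\rangle:y\in D,\ \|x-y\|<1\}$; for $D=X$ this is $m(x):=\inf\{\|x^*\|_*:x^*\in\partial J(x)\}$. For $D_1\subset D$, $J$ satisfies the non-smooth $C$-condition on $D_1$ with respect to $D$ if every sequence $\{x_n\}\subset D_1$ such that $J(x_n)\to c$ for some $c\in\mathbb R$ and $(1+\|x_n\|)m_D(x_n)\to0$ has a convergent subsequence. Notation: $\mathbb K_r=\{x\in X:m(x)=0,\ J(x)=r\}$; $J^{c}=\{x\in X:J(x)\le c\}$; for $K\subset X$ and $\rho>0$, $(K)_\rho=\{x\in X:\operatorname{dist}(x,K)<\rho\}$ (empty if $K=\emptyset$). *)

(* Defs.v *)
From HB Require Import structures.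
From mathcomp Require Import all_boot all_order all_algebra.
From mathcomp Require Import all_classical all_reals all_analysis.

Set Implicit Arguments.
Unset Strict Implicit.
Unset Printing Implicit Defensive.

Import Order.TTheory GRing.Theory Num.Theory.
Import numFieldNormedType.Exports.

Local Open Scope classical_set_scope.
Local Open Scope ring_scope.

Section Dual.
Context {R : realType} {X : normedModType R}.

(* The dual space X^* is represented by the set of its elements inside the
   vector space of all functions X -> R, with pointwise operations. *)
Definition dual : set (X -> R^o) := [set f | linear f /\ continuous f].

Definition dual_norm (f : X -> R^o) : R :=
  sup [set `|f x| | x in [set x | `|x| <= 1]].

(* phi is an element of the bidual; its values outside the dual are irrelevant. *)
Definition bidual (phi : (X -> R^o) -> R) : Prop :=
  (forall (a : R) (f g : X -> R^o), dual f -> dual g ->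
     phi (a *: f + g) = a * phi f + phi g) /\
  (exists C : R, forall f, dual f -> `|phi f| <= C * dual_norm f).

Definition reflexive_space : Prop :=
  forall phi, bidual phi -> exists x : X, forall f, dual f -> phi f = f x.

Definition duality_map (f : X -> R^o) : set X :=
  [set x | f x = dual_norm f ^+ 2 /\ dual_norm f ^+ 2 = `|x| ^+ 2].

End Dual.

Arguments reflexive_space {R} X.

Section Sets.
Context {R : realType} {X : normedModType R}.

Definition boundary (A : set X) : set X := closure A `\` A°.

Definition is_cone (P : set X) : Prop :=
  [/\ closed P,
      convex_set (P : set (convex_lmodType X)),
      (forall (l : R) x, 0 <= l -> P x -> P (l *: x)) &
      P `&` [set - x | x in P] = [set 0]].

Definition closed_nbhd (A : set X) (mu : R) : set X :=
  [set x | (edist_inf A x <= mu%:E)%E].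

(* This is empty if A is: edist_inf set0 x = +oo. *)
Definition open_nbhd (A : set X) (rho : R) : set X :=
  [set x | (edist_inf A x < rho%:E)%E].

Definition Dpos (P : set X) (mu : R) : set X := closed_nbhd P mu.

Definition Dneg (P : set X) (mu : R) : set X :=
  closed_nbhd [set - x | x in P] mu.

Definition homeomorphism (f : X -> X) : Prop :=
  exists g : X -> X,
    [/\ cancel f g, cancel g f, continuous f & continuous g].

End Sets.

Section Nonsmooth.
Context {R : realType} {X : normedModType R}.
Variable J : X -> R^o.

Definition locally_lipschitz : Prop :=
  forall x : X, exists2 U : set X, nbhs x U & [lipschitz J y | y in U].

(* limsup of (J (y + t v) - J y) / t as y -> x and t decreases to 0 *)
Definition clarke_derivative (x v : X) : \bar R :=
  limf_esup (fun yt : X * R => ((J (yt.1 + yt.2 *: v) - J yt.1) / yt.2)%:E)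
            (filter_prod (nbhs x) (0 : R)^'+).

Definition subdifferential (x : X) : set (X -> R^o) :=
  [set f | dual f /\ forall v, ((f v)%:E <= clarke_derivative x v)%E].

Definition set_gradient (x : X) : set X :=
  \bigcup_(f in subdifferential x) duality_map f.

Definition id_sub_gradient_maps (A B : set X) : Prop :=
  forall x y, A x -> set_gradient x y -> B (x - y).

(* For x in D and J locally Lipschitz, the sets below are nonempty and bounded
   on the relevant side, so that these are true suprema and infima. *)
Definition slope_on (D : set X) (x : X) : R :=
  inf [set sup [set f (x - y) | y in [set y | D y /\ `|x - y| < 1]]
      | f in subdifferential x].

Definition slope (x : X) : R := inf [set dual_norm f | f in subdifferential x].

Definition C_condition (D1 D : set X) : Prop :=
  forall u : nat -> X, (forall n, D1 (u n)) ->
    (exists c : R, J (u n) @[n --> \oo] --> c) ->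
    (1 + `|u n|) * slope_on D (u n) @[n --> \oo] --> (0 : R) ->
    exists phi : nat -> nat,
      {homo phi : m n / (m < n)%N} /\ cvg (u (phi n) @[n --> \oo]).

Definition critical_level (r : R) : set X := [set x | slope x = 0 /\ J x = r].

Definition sublevel (c : R) : set X := [set x | J x <= c].

End Nonsmooth.

(* Main.v *)
Require Import Defs.
From HB Require Import structures.
From mathcomp Require Import all_boot all_order all_algebra.
From mathcomp Require Import all_classical all_reals all_analysis.
From mathcomp Require wochoice.
From mathcomp Require Import ring lra.

(* Outside a neighbourhood of [K2] and outside the interiors of [Dp] and [Dm],
   the C-condition bounds [(1 + |x|) slope x] from below near level [r], because
   condition (a) puts every critical point of [Dp `|` Dm] in one of the two
   interiors.  At each point [a] of that region a Hahn-Banach separation yields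
   a unit vector [v] that decreases [J] on all short segments close to [a] and
   that respects [Dp] and [Dm]; on the boundary of [Dp] it can be taken
   inward, since minus a duality image of a subgradient points inward.

   No flow is integrated.  Stone's separation of the cells of a cover gives a
   sequence of Lipschitz maps [x + g n x], each moving a point along the
   descent vector of one cell without leaving that cell.  Applying them so that
   every [n] recurs, an orbit of the region with [J] bounded below has finite
   length, by the C-condition bound; its limit would lie in the region and be
   moved by some [g n], a contradiction.  So each orbit leaves the region, and
   by compactness of [A] a common finite number of steps suffices; [eta]
   concatenates the corresponding isotopies. *)

Set Implicit Arguments.
Unset Strict Implicit.
Unset Printing Implicit Defensive.

Import Order.TTheory GRing.Theory Num.Theory.
Import numFieldNormedType.Exports.

Local Open Scope classical_set_scope.
Local Open Scope ring_scope.

(** * Sublinear functions, Hahn-Banach and Mazur-Orlicz *)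

Section HahnBanach.
Context {R : realType} {V : lmodType R}.
Implicit Types (p q : V -> R) (K : set (V * R)).

Definition sublinear p :=
  (forall u v, p (u + v) <= p u + p v) /\
  (forall t u, 0 <= t -> p (t *: u) <= t * p u).

Lemma sublinear0 p : sublinear p -> p 0 = 0.
Proof.
move=> [pD pZ]; apply/eqP; rewrite eq_le; apply/andP; split.
  by have := pZ 0 0 (lexx _); rewrite scale0r mul0r.
by have := pD 0 0; rewrite addr0; lra.
Qed.

Lemma sublinearZ p t u : sublinear p -> 0 <= t -> p (t *: u) = t * p u.
Proof.
move=> sp t0; have [pD pZ] := sp; apply/eqP; rewrite eq_le pZ//=.
have [<-|tN0] := eqVneq 0 t; first by rewrite scale0r mul0r sublinear0.
have tp : 0 < t by rewrite lt_def eq_sym tN0.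
have := pZ t^-1 (t *: u); rewrite invr_ge0 => /(_ t0).
by rewrite scalerA mulVf ?gt_eqF// scale1r -ler_pdivrMl ?invr_gt0// invrK.
Qed.

Lemma sublinearN p u : sublinear p -> - p (- u) <= p u.
Proof.
by move=> sp; have := sp.1 u (- u); rewrite subrr sublinear0//; lra.
Qed.

Definition convex_cone K :=
  [/\ K (0, 0), (forall v c w d, K (v, c) -> K (w, d) -> K (v + w, c + d)) &
      (forall t v c, 0 <= t -> K (v, c) -> K (t *: v, t * c))].

(** For [p] sublinear and [K] a convex cone as below, the linear functions under it are exactly the
    linear [f <= p] with [0 <= f v + c] on [K]: the constraints are absorbed into the dominating
    function. *)
Definition inf_shift p K u := inf [set p (u + z.1) + z.2 | z in K].

Section inf_shift.
Variables (p : V -> R) (K : set (V * R)).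
Hypotheses (sp : sublinear p) (cK : convex_cone K).
Hypothesis pK : forall v c, K (v, c) -> 0 <= p v + c.

(** This bound makes the infimum genuine rather than a default value. *)
Let lb u : lbound [set p (u + z.1) + z.2 | z in K] (- p (- u)).
Proof.
move=> _ [[v c] Kz <-] /=.
have := pK Kz; have := sp.1 (u + v) (- u); rewrite addrAC subrr add0r; lra.
Qed.

Lemma inf_shift_le u v c : K (v, c) -> inf_shift p K u <= p (u + v) + c.
Proof.
move=> Kz; apply: ge_inf; first by exists (- p (- u)); exact: lb.
by exists (v, c).
Qed.

Lemma le_inf_shift u x :
  (forall v c, K (v, c) -> x <= p (u + v) + c) -> x <= inf_shift p K u.
Proof.
move=> h; apply: lb_le_inf; last by move=> _ [[v c] Kz <-]; exact: h.
by exists (p (u + 0) + 0), (0, 0) => //; have [] := cK.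
Qed.

Lemma inf_shift_le_id u : inf_shift p K u <= p u.
Proof.
by have [K0 _ _] := cK; have := inf_shift_le u K0; rewrite !addr0.
Qed.

Lemma sublinear_inf_shift : sublinear (inf_shift p K).
Proof.
have [K0 KD KZ] := cK; split=> [u v|t u t0].
  rewrite -lerBlDr; apply: le_inf_shift => w c Kw.
  rewrite lerBlDr -lerBlDl; apply: le_inf_shift => w' c' Kw'.
  rewrite lerBlDl (le_trans (inf_shift_le _ (KD _ _ _ _ Kw Kw')))//.
  by rewrite addrACA; have := sp.1 (u + w) (v + w'); lra.
have [<-|tN0] := eqVneq 0 t.
  rewrite scale0r mul0r; have := inf_shift_le 0 K0.
  by rewrite !addr0 (sublinear0 sp).
have tp : 0 < t by rewrite lt_def eq_sym tN0.
rewrite -ler_pdivrMl//; apply: le_inf_shift => v c Kv.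
rewrite ler_pdivrMl// mulrDr (le_trans (inf_shift_le _ (KZ _ _ _ t0 Kv)))//.
by rewrite -scalerDr lerD2r sp.2.
Qed.

End inf_shift.

(* A sublinear function that is minimal for the pointwise order is linear,
   as [inf_shift] along a ray [t *: (v, - q v)] cannot decrease it. *)
Lemma hahn_banach p : sublinear p ->
  exists f : V -> R^o, linear f /\ forall u, f u <= p u.
Proof.
move=> sp.
pose T := {q : V -> R | sublinear q /\ forall u, q u <= p u}.
pose mk q sq qp : T := exist _ q (conj sq qp).
(* The order is reversed, so the maximal element given by [Zorn] is a pointwise minimal sublinear
   function. *)
pose le (q1 q2 : T) := `[< forall u, sval q2 u <= sval q1 u >].
have [||||[q [sq qp]] qmin] := @Zorn T le.
- by move=> q; apply/asboolP.
- move=> q1 q2 q3 /asboolP h12 /asboolP h23; apply/asboolP => u.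
  exact: le_trans (h23 u) (h12 u).
- move=> [q1 ?] [q2 ?] /asboolP h12 /asboolP h21; apply/eq_exist/funext => u.
  by apply/eqP; rewrite eq_le h12 h21.
- move=> A totA; have [[q0 Aq0]|A0] := pselect (A !=set0); last first.
    exists (mk _ sp (fun=> lexx _)) => s As.
    by exfalso; apply: A0; exists s.
  pose I u := [set sval q u | q in A].
  have lbI u : lbound (I u) (- p (- u)).
    move=> _ [q Aq <-]; have [sq qp] := svalP q.
    by apply: le_trans (sublinearN u sq); rewrite lerN2.
  have leI (q : T) u : A q -> inf (I u) <= sval q u.
    by move=> Aq; apply: ge_inf; [exists (- p (- u)); exact: lbI|exists q].
  have Ile u x : (forall q : T, A q -> x <= sval q u) -> x <= inf (I u).
    move=> h; apply: lb_le_inf; first by exists (sval q0 u), q0.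
    by move=> _ [q Aq <-]; exact: h.
  have sI : sublinear (fun u => inf (I u)).
    split=> [u v|t u t0].
      rewrite -lerBlDr; apply: (Ile _ _) => q Aq.
      rewrite lerBlDr -lerBlDl; apply: (Ile _ _) => q' Aq'; rewrite lerBlDl.
      (* Of the members of the chain used at [u] and at [v], the smaller one serves both points. *)
      have [/asboolP qq'|/asboolP qq'] := totA _ _ Aq Aq'.
        apply: (le_trans (leI _ (u + v) Aq')); have [sq _] := svalP q'.
        by have := sq.1 u v; have := qq' u; lra.
      apply: (le_trans (leI _ (u + v) Aq)); have [sq _] := svalP q.
      by have := sq.1 u v; have := qq' v; lra.
    have [<-|tN0] := eqVneq 0 t.
      rewrite scale0r mul0r (le_trans (leI _ _ Aq0))//.
      by have [sq _] := svalP q0; rewrite sublinear0.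
    have tp : 0 < t by rewrite lt_def eq_sym tN0.
    rewrite -ler_pdivrMl//; apply: (Ile _ _) => q Aq.
    rewrite ler_pdivrMl// (le_trans (leI _ _ Aq))//.
    by have [sq _] := svalP q; exact: sq.2.
  have Ip u : inf (I u) <= p u.
    by apply: (le_trans (leI _ _ Aq0)); have [_] := svalP q0; exact.
  by exists (mk _ sI Ip) => s As; apply/asboolP => u /=; exact: leI.
have qD u v : q (u + v) = q u + q v.
  pose K := [set (t *: v, - (t * q v)) | t in [set t : R | 0 <= t]].
  have cK : convex_cone K.
    split.
    - by exists 0 => //=; rewrite scale0r mul0r oppr0.
    - move=> _ _ _ _ [t t0 [<- <-]] [s s0 [<- <-]]; exists (t + s).
        exact: addr_ge0.
      by rewrite scalerDl mulrDl opprD.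
    - move=> t _ _ t0 [s s0 [<- <-]]; exists (t * s); first exact: mulr_ge0.
      by rewrite scalerA mulrN mulrA.
  have qK w c : K (w, c) -> 0 <= q w + c.
    by move=> [t t0 [<- <-]]; rewrite sublinearZ// subrr.
  have sq' := sublinear_inf_shift sq cK qK.
  have q'p w : inf_shift q K w <= p w.
    exact: le_trans (inf_shift_le_id sq cK qK w) (qp w).
  have qE : inf_shift q K = q.
    suff : mk _ sq' q'p = mk _ sq qp by case.
    by apply: qmin; apply/asboolP => w /=; exact: inf_shift_le_id.
  apply/eqP; rewrite eq_le sq.1 /=.
  have Kv : K (v, - q v) by exists 1 => //=; rewrite scale1r mul1r.
  have := inf_shift_le sq qK u Kv.
  by rewrite qE; lra.
have q0 := sublinear0 sq.
have qN u : q (- u) = - q u by have := qD u (- u); rewrite subrr q0; lra.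
exists q; split=> // t u v; rewrite qD; congr (_ + _).
have [t0|t0] := leP 0 t; first by rewrite sublinearZ.
rewrite -[t]opprK scaleNr qN sublinearZ ?oppr_ge0 ?ltW//.
by rewrite opprK /GRing.scale/= mulNr !opprK.
Qed.

(** Hahn-Banach is applied to [inf_shift p K]. Its value at [- v] is at most [c] for [(v, c)] in
    [K], which is the constraint. *)
Lemma mazur_orlicz p K : sublinear p -> convex_cone K ->
  (forall v c, K (v, c) -> 0 <= p v + c) ->
  exists f : V -> R^o, [/\ linear f, forall u, f u <= p u &
    forall v c, K (v, c) -> 0 <= f v + c].
Proof.
move=> sp cK pK.
have [f [lf fle]] := hahn_banach (sublinear_inf_shift sp cK pK).
exists f; split=> // [u|v c Kv].
  exact: le_trans (fle u) (inf_shift_le_id sp cK pK u).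
have := inf_shift_le sp pK (- v) Kv; rewrite addNr sublinear0// add0r.
pose lfun : {linear V -> R^o} := HB.pack f (GRing.isLinear.Build _ _ _ _ f lf).
have fN : f (- v) = - f v := linearN lfun v.
by have := fle (- v); rewrite fN; lra.
Qed.

End HahnBanach.

(** * The Clarke directional derivative of a locally Lipschitz function *)

Section Clarke.
Context {R : realType} {X : normedModType R}.
Variable J : X -> R^o.

(** Together with [clarke_le_quotient], this replaces the upper limit over a product filter by
    uniform bounds on increments, the form used in the estimates below. *)
Lemma clarke_lt_quotient x v (a : R) :
  (clarke_derivative J x v < a%:E)%E ->
  exists2 d : R, 0 < d & forall z t, `|z - x| < d -> 0 < t < d ->
    J (z + t *: v) - J z <= a * t.
Proof.
move=> /ereal_inf_lt[_ [V FV <-]] supVa.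
have [[A B] /= [xA B0] ABV] := FV.
have /nbhs_ballP[d1 /= d10 d1A] := xA.
have [d2 /= d20 d2B] := B0.
exists (Num.min d1 d2); first by rewrite lt_min d10.
move=> z t; rewrite !lt_min => /andP[zd1 _] /and3P[t0 _ td2].
rewrite -ler_pdivrMr// -lee_fin; apply: le_trans (ltW supVa).
apply: ereal_sup_ubound; exists (z, t) => //; apply: ABV; split => /=.
  by apply: d1A; rewrite -ball_normE /= distrC.
by apply: d2B => //=; rewrite sub0r normrN gtr0_norm.
Qed.

Lemma clarke_le_quotient x v (a d : R) : 0 < d ->
  (forall z t, `|z - x| < d -> 0 < t < d -> J (z + t *: v) - J z <= a * t) ->
  (clarke_derivative J x v <= a%:E)%E.
Proof.
move=> d0 h.
pose V := ([set z : X | `|z - x| < d] `*` [set t : R | 0 < t < d]).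
apply: (@le_trans _ _ (ereal_sup
  [set ((J (yt.1 + yt.2 *: v) - J yt.1) / yt.2)%:E | yt in V])).
  apply: ereal_inf_lbound; exists V => //.
  exists ([set z : X | `|z - x| < d], [set t : R | 0 < t < d]) => //=; split.
    by apply/nbhs_ballP; exists d => //= z; rewrite -ball_normE /= distrC.
  by exists d => //= t /=; rewrite sub0r normrN => /ltr_normlW -> ->.
apply: ge_ereal_sup => _ [[z t] [/= zd td] <-]; rewrite lee_fin.
by rewrite ler_pdivrMr ?h//; case/andP: td.
Qed.

Hypothesis lipJ : locally_lipschitz J.

Lemma locally_lipschitz_ball x : exists2 L : R, 0 <= L &
  exists2 d : R, 0 < d & forall y z, `|y - x| < d -> `|z - x| < d ->
    `|J y - J z| <= L * `|y - z|.
Proof.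
have [U xU [M [_ hM]]] := lipJ x; have /nbhs_ballP[d /= d0 dU] := xU.
(* The Lipschitz bound is available for every constant beyond [M]; this one is also nonnegative. *)
have M1 : M < `|M| + 1 by rewrite (le_lt_trans (ler_norm _))// ltrDl.
exists (`|M| + 1); first by rewrite addr_ge0.
exists d => // y z yd zd; apply: (hM _ M1 (y, z)).
by split; apply: dU; rewrite -ball_normE /= distrC.
Qed.

Lemma locally_lipschitz_continuous : continuous (J : X -> R).
Proof.
move=> x; have [L L0 [d d0 hL]] := locally_lipschitz_ball x.
apply/cvgrPdist_lt => e e0; near=> y.
have yd : `|y - x| < d.
  by near: y; apply/nbhs_ballP; exists d => //= z; rewrite -ball_normE /= distrC.
have ye : `|y - x| < e / (L + 1).
  near: y; apply/nbhs_ballP; exists (e / (L + 1)) => //=; last first.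
    by move=> z; rewrite -ball_normE /= distrC.
  by rewrite divr_gt0// ltr_wpDl.
apply: le_lt_trans (hL _ _ _ yd) _; first by rewrite subrr normr0.
rewrite distrC; apply: (@le_lt_trans _ _ ((L + 1) * `|y - x|)).
  by rewrite ler_wpM2r// lerDl.
by rewrite mulrC -ltr_pdivlMr// ltr_wpDl.
Unshelve. all: by end_near. Qed.

Lemma clarke_bounds x : exists2 L : R, 0 <= L & forall v,
  ((- (L * `|v|))%:E <= clarke_derivative J x v)%E /\
  (clarke_derivative J x v <= (L * `|v|)%:E)%E.
Proof.
have [L L0 [d d0 hL]] := locally_lipschitz_ball x; exists L => // v.
have v1 : 0 < 1 + `|v| by rewrite ltr_pwDl.
have dv : 0 < d / (1 + `|v|) by rewrite divr_gt0.
(* This radius keeps both [z] and [z + t *: v] within [d] of [x]. *)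
have quot z t : `|z - x| < d / (1 + `|v|) -> 0 < t < d / (1 + `|v|) ->
    `|J (z + t *: v) - J z| <= L * `|v| * t.
  move=> zx /andP[t0 td].
  have vt : `|t *: v| = `|v| * t by rewrite normrZ gtr0_norm// mulrC.
  have dE : d / (1 + `|v|) * (1 + `|v|) = d by rewrite divfK ?gt_eqF.
  have dle : d / (1 + `|v|) <= d by rewrite ler_pdivrMr// mulrDr mulr1 lerDl mulr_ge0// ltW.
  have := hL (z + t *: v) z; rewrite [_ + _ - z]addrC addKr vt mulrA; apply.
    rewrite addrAC (le_lt_trans (ler_normD _ _))// vt -[ltRHS]dE mulrDr mulr1.
    by rewrite ltr_leD// mulrC ler_wpM2r// ltW.
  exact: lt_le_trans zx dle.
split; last first.
  apply: (clarke_le_quotient dv) => z t zx td.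
  exact: le_trans (ler_norm _) (quot z t zx td).
(* One quotient, at the base point [x] with a time small enough for both estimates, already bounds
   [b] from below. *)
have lb (b : R) : (clarke_derivative J x v < b%:E)%E -> - (L * `|v|) <= b.
  move=> /clarke_lt_quotient[e e0 he].
  pose t := Num.min e (d / (1 + `|v|)) / 2.
  have t0 : 0 < t by rewrite divr_gt0// lt_min e0.
  have tlt : t < Num.min e (d / (1 + `|v|)).
    by rewrite /t ltr_pdivrMr// ltr_pMr ?ltr1n// lt_min e0.
  move: tlt; rewrite lt_min => /andP[te td].
  have := he x t; rewrite subrr normr0 t0 te => /(_ e0 isT) h1.
  have := quot x t; rewrite subrr normr0 t0 td => /(_ dv isT).
  rewrite ler_norml => /andP[h2 _].
  by rewrite -(ler_pM2r t0) mulNr (le_trans h2).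
case: (clarke_derivative J x v) lb => [c| |] lb; rewrite ?leey//.
  rewrite lee_fin; apply/ler_addgt0Pr => e e0.
  by apply: lb; rewrite lte_fin ltrDl.
by exfalso; have := lb (- (L * `|v|) - 1) (ltNyr _); lra.
Qed.

Lemma clarke_fin_num x v : clarke_derivative J x v \is a fin_num.
Proof.
have [L _ /(_ v)[]] := clarke_bounds x.
by case: clarke_derivative.
Qed.

Definition clarke x v : R := fine (clarke_derivative J x v).

Lemma clarkeE x v : clarke_derivative J x v = (clarke x v)%:E.
Proof. by rewrite /clarke fineK// clarke_fin_num. Qed.

Lemma clarke_norm_le x : exists2 L : R, 0 <= L & forall v,
  `|clarke x v| <= L * `|v|.
Proof.
have [L L0 h] := clarke_bounds x; exists L => // v.
have [] := h v; rewrite clarkeE !lee_fin => h1 h2.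
by rewrite ler_norml h1.
Qed.

Lemma clarke_quotient x v a : clarke x v < a ->
  exists2 d : R, 0 < d & forall z t, `|z - x| < d -> 0 < t < d ->
    J (z + t *: v) - J z <= a * t.
Proof. by rewrite -lte_fin -clarkeE; exact: clarke_lt_quotient. Qed.

Lemma clarke_le x v a d : 0 < d ->
  (forall z t, `|z - x| < d -> 0 < t < d -> J (z + t *: v) - J z <= a * t) ->
  clarke x v <= a.
Proof. by rewrite -lee_fin -clarkeE; exact: clarke_le_quotient. Qed.

(** The increment along [u + v] splits into one along [v] from [z] and one along [u] from
    [z + t *: v]. The moving base point in the Clarke derivative absorbs this shift. *)
Lemma clarke_sublinear x : sublinear (clarke x).
Proof.
split=> [u v|t u].
  apply/ler_addgt0Pr => e e0.
  have e20 : 0 < e / 2 by rewrite divr_gt0.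
  have [d d0 hd] : exists2 d : R, 0 < d & forall z t, `|z - x| < d ->
      0 < t < d -> J (z + t *: u) - J z <= (clarke x u + e / 2) * t.
    by apply: clarke_quotient; rewrite ltrDl.
  have [c c0 hc] : exists2 d : R, 0 < d & forall z t, `|z - x| < d ->
      0 < t < d -> J (z + t *: v) - J z <= (clarke x v + e / 2) * t.
    by apply: clarke_quotient; rewrite ltrDl.
  have v1 : 0 < 1 + `|v| by rewrite ltr_pwDl.
  have m0 : 0 < Num.min (d / (1 + `|v|)) c by rewrite lt_min divr_gt0.
  apply: (clarke_le m0) => z t.
  rewrite !lt_min => /andP[zd zc] /and3P[t0 td tc].
  have dE : d / (1 + `|v|) * (1 + `|v|) = d by rewrite divfK ?gt_eqF.
  have dle : d / (1 + `|v|) <= d by rewrite ler_pdivrMr// mulrDr mulr1 lerDl mulr_ge0// ltW.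
  have := hc z t zc; rewrite t0 tc => /(_ isT).
  have := hd (z + t *: v) t; rewrite t0 (lt_le_trans td dle).
  rewrite scalerDr [t *: u + _]addrC addrA => h1.
  suff /h1/(_ isT) : `|z + t *: v - x| < d by lra.
  rewrite addrAC (le_lt_trans (ler_normD _ _))// normrZ gtr0_norm//.
  by rewrite -[ltRHS]dE mulrDr mulr1 ltr_leD// ler_wpM2r// ltW.
rewrite le_eqVlt => /orP[/eqP<-|t0].
  rewrite scale0r mul0r; apply: (@clarke_le _ _ _ 1) => // z s _ _.
  by rewrite scaler0 addr0 subrr mul0r.
rewrite -ler_pdivrMl//; apply/ler_addgt0Pr => e e0.
have [d d0 hd] : exists2 d : R, 0 < d & forall z t, `|z - x| < d ->
    0 < t < d -> J (z + t *: u) - J z <= (clarke x u + e) * t.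
  by apply: clarke_quotient; rewrite ltrDl.
rewrite ler_pdivrMl//.
have m0 : 0 < Num.min d (d / t) by rewrite lt_min d0 divr_gt0.
apply: (clarke_le m0) => z s.
rewrite !lt_min => /andP[zd _] /and3P[s0 _ sd].
rewrite scalerA (_ : t * _ * s = (clarke x u + e) * (s * t)); last by ring.
apply: hd => //.
by rewrite mulr_gt0//= -ltr_pdivlMr.
Qed.

(** Continuity of [f] comes from the bound of [clarke x v] by a multiple of the norm of [v], so
    Hahn-Banach functionals become subgradients directly. *)
Lemma dual_subdifferentialP x (f : X -> R^o) : linear f ->
  (forall v, f v <= clarke x v) -> subdifferential J x f.
Proof.
move=> lf fle; split; last by move=> v; rewrite clarkeE lee_fin.
split=> //.
pose lfun : {linear X -> R^o} := HB.pack f (GRing.isLinear.Build _ _ _ _ f lf).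
have [L L0 hL] := clarke_norm_le x.
suff : continuous lfun by [].
apply: bounded_linear_continuous.
apply/linear_boundedP; near=> k => v.
have vN : `|f v| <= L * `|v|.
  have fN : f (- v) = - f v := linearN lfun v.
  rewrite ler_norml; apply/andP; split.
    rewrite lerNl -fN (le_trans (fle _))// (le_trans (ler_norm _))//.
    by rewrite (le_trans (hL _))// normrN.
  by rewrite (le_trans (fle _))// (le_trans (ler_norm _)).
by apply: le_trans vN _; rewrite ler_wpM2r.
Unshelve. all: by end_near. Qed.

End Clarke.

(** * The dual norm, norm attainment under reflexivity and the duality map *)

Section DualNorm.
Context {R : realType} {X : normedModType R}.
Implicit Types f g : X -> R^o.

Lemma dual_bound f x : dual f -> `|f x| <= dual_norm f * `|x|.
Proof.
move=> [lf cf].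
pose lfun : {linear X -> R^o} := HB.pack f (GRing.isLinear.Build _ _ _ _ f lf).
(* Boundedness shows that the supremum in [dual_norm f] is genuine. *)
have [M M0 hM] : exists2 M : R, 0 < M & forall x, `|f x| <= M * `|x|.
  have /linear_boundedP[M [_ hM]] : bounded_near lfun (nbhs 0).
    by apply: continuous_linear_bounded; exact: cf.
  have MM : M < `|M| + 1 by rewrite (le_lt_trans (ler_norm _))// ltrDl.
  by exists (`|M| + 1); [rewrite ltr_wpDl|exact: hM].
have ub : has_ubound [set `|f x| | x in [set x | `|x| <= 1]].
  exists M => _ [z /= z1 <-]; rewrite (le_trans (hM z))//.
  by rewrite ler_piMr// ltW.
have [->|x0] := eqVneq x 0.
  have f0 : f 0 = 0 := linear0 lfun.
  by rewrite f0 !normr0 mulr0.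
have nx : 0 < `|x| by rewrite normr_gt0.
rewrite -ler_pdivrMr//; apply: ub_le_sup => //.
exists (`|x|^-1 *: x); first by rewrite /= normrZ normfV normr_id mulVf ?gt_eqF.
have -> : f (`|x|^-1 *: x) = `|x|^-1 *: f x := linearZ_LR lfun _ _.
by rewrite normrZ normfV normr_id mulrC.
Qed.

Lemma dual_norm_le f c : 0 <= c -> (forall x, `|f x| <= c * `|x|) ->
  dual_norm f <= c.
Proof.
move=> c0 h; apply: ge_sup; first by exists `|f 0|, 0 => //=; rewrite normr0.
by move=> _ [x /= x1 <-]; rewrite (le_trans (h x))// ler_piMr.
Qed.

Lemma dual_norm_ge0 f : dual f -> 0 <= dual_norm f.
Proof.
move=> df; have [[x x0]|h] := pselect (exists x : X, x != 0).
  have nx : 0 < `|x| by rewrite normr_gt0.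
  by rewrite -(pmulr_lge0 _ nx) (le_trans _ (dual_bound x df)).
have f0 : f 0 = 0.
  apply/eqP; rewrite -normr_le0 (le_trans (dual_bound 0 df))//.
  by rewrite ?normr0 mulr0.
rewrite /dual_norm (_ : [set `|f x| | x in _] = [set 0]) ?sup1//.
apply/seteqP; split => [_ [x _ <-]|_ ->] /=; last first.
  by exists 0; rewrite /= ?f0 normr0.
have [->|x0] := eqVneq x 0; first by rewrite f0 normr0.
by exfalso; apply: h; exists x.
Qed.

(** Mazur-Orlicz for the norm, with the ray through [(y, - |y|)] as constraint cone. *)
Lemma norming_functional (y : X) : exists g : X -> R^o,
  [/\ dual g, dual_norm g <= 1 & `|y| <= g y].
Proof.
pose p (x : X) : R := `|x|.
have sp : sublinear p.
  by split=> [u v|t u t0]; [exact: ler_normD|rewrite /p normrZ ger0_norm].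
pose K := [set (t *: y, - (t * `|y|)) | t in [set t : R | 0 <= t]].
have cK : convex_cone K.
  split.
  - by exists 0 => //=; rewrite scale0r mul0r oppr0.
  - move=> _ _ _ _ [t t0 [<- <-]] [s s0 [<- <-]]; exists (t + s).
      exact: addr_ge0.
    by rewrite scalerDl mulrDl opprD.
  - move=> t _ _ t0 [s s0 [<- <-]]; exists (t * s); first exact: mulr_ge0.
    by rewrite scalerA mulrN mulrA.
have pK w c : K (w, c) -> 0 <= p w + c.
  by move=> [t t0 [<- <-]]; rewrite /p normrZ ger0_norm// subrr.
have [g [lg gp gK]] := mazur_orlicz sp cK pK.
pose lfun : {linear X -> R^o} := HB.pack g (GRing.isLinear.Build _ _ _ _ g lg).
have gle x : `|g x| <= 1 * `|x|.
  rewrite mul1r ler_norml gp andbT lerNl.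
  have <- : g (- x) = - g x := linearN lfun x.
  by rewrite (le_trans (gp _))// /p normrN.
have dg : dual g.
  split=> //; suff : continuous lfun by [].
  apply: bounded_linear_continuous; apply/linear_boundedP; near=> k => v.
  by apply: le_trans (gle v) _; rewrite ler_wpM2r.
exists g; split=> //; first exact: dual_norm_le.
have /gK : K (y, - `|y|) by exists 1 => //=; rewrite scale1r mul1r.
by rewrite subr_ge0.
Unshelve. all: by end_near. Qed.

(** Limits along an ultrafilter that refines the almost maximizing sets [B e] define an element of
    the bidual. Reflexivity represents it by a point [y], where [f] takes its norm; a norming
    functional of [y] gives [|y| <= 1]. *)
Lemma reflexive_norm_attained f : reflexive_space X -> dual f ->
  exists y : X, `|y| <= 1 /\ f y = dual_norm f.
Proof.
move=> refl df; set M := dual_norm f.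
pose lfun : {linear X -> R^o} := HB.pack f (GRing.isLinear.Build _ _ _ _ f df.1).
pose B (e : R) := [set x : X | `|x| <= 1 /\ M - e < f x].
have fM x : `|x| <= 1 -> `|f x| <= M.
  by move=> x1; rewrite (le_trans (dual_bound x df))// ler_piMr// dual_norm_ge0.
have B0 (e : R) : 0 < e -> B e !=set0.
  move=> e0.
  have hs : has_sup [set `|f x| | x in [set x | `|x| <= 1]].
    split; first by exists `|f 0|, 0 => //=; rewrite normr0.
    by exists M => _ [x /= x1 <-]; exact: fM.
  have [_ [x /= x1 <-] xM] := sup_adherent e0 hs.
  have [fx0|fx0] := leP 0 (f x); first by exists x; split; rewrite // -(ger0_norm fx0).
  exists (- x); split; first by rewrite normrN.
  by have -> : f (- x) = - f x := linearN lfun x; rewrite -(ltr0_norm fx0).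
pose F := filter_from [set e : R | 0 < e] B.
have FF : ProperFilter F.
  apply: filter_from_proper => //; apply: filter_from_filter; first by exists 1 => /=.
  move=> i j /= i0 j0; exists (Num.min i j); first by rewrite /= lt_min i0.
  move=> x [x1 xM]; split; split => //; apply: le_lt_trans xM.
    by rewrite lerB// ge_min lexx.
  by rewrite lerB// ge_min lexx orbT.
have [U [UU FU]] := ultraFilterLemma FF.
have UF : ProperFilter U by exact: ultra_proper.
have U1 : U [set x | `|x| <= 1] by apply: FU; exists 1 => //= x [].
(* On the unit ball [g] takes values in a compact segment, so its limit along the ultrafilter
   exists. *)
have cvgU g : dual g -> exists2 l : R, `|l| <= dual_norm g & g x @[x --> U] --> (l : R^o).
  move=> dg; pose G : set_system R := g x @[x --> U].
  have GF : ProperFilter G by exact: fmap_proper_filter.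
  have [] := @segment_compact R (- dual_norm g) (dual_norm g) G GF.
    have UgS (A : set R) : U (g @^-1` A) -> G A by [].
    apply: UgS; apply: filterS U1 => x /= x1; rewrite in_itv/= -ler_norml.
    by rewrite (le_trans (dual_bound x dg))// ler_piMr// dual_norm_ge0.
  move=> l [/=]; rewrite in_itv/= -ler_norml => lg lcl; exists l => // V lV.
  have [//|UnV] := in_ultra_setVsetC (g @^-1` V) UU.
  by have [z []] := lcl (~` V) V UnV lV.
pose phi g : R := lim (g x @[x --> U]).
have phiE g (l : R) : g x @[x --> U] --> (l : R^o) -> phi g = l.
  by move=> gl; apply/cvg_lim.
have phi_bidual : bidual phi.
  split=> [a g h dg dh|].
    have [l _ gl] := cvgU g dg; have [k _ hk] := cvgU h dh.
    rewrite (phiE _ _ gl) (phiE _ _ hk); apply: phiE.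
    have FU0 : Filter U by exact: filter_filter.
    exact: (cvgD (cvgZl_tmp (k := a) gl) hk).
  exists 1 => g dg; have [l lg gl] := cvgU g dg.
  by rewrite (phiE _ _ gl) mul1r.
have [y hy] := refl _ phi_bidual; exists y; split; last first.
  rewrite -hy//; apply: phiE; apply/cvgrPdist_lt => e e0.
  apply: FU; exists e => // x [x1 xM] /=.
  rewrite ger0_norm ?subr_ge0 ?(le_trans (ler_norm _) (fM x x1))//.
  by rewrite ltrBlDl -ltrBlDr.
have [g [dg g1 gy]] := norming_functional y.
rewrite (le_trans gy)// -hy//; have [l lg gl] := cvgU g dg.
by rewrite (phiE _ _ gl) (le_trans (ler_norm _))// (le_trans lg).
Qed.

(** A point of the unit ball where [f] attains its norm is scaled by that norm; it has norm one
    unless [f] has dual norm zero. *)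
Lemma duality_map_nonempty f : reflexive_space X -> dual f ->
  exists y : X, duality_map f y.
Proof.
move=> refl df; have [y [y1 fy]] := reflexive_norm_attained refl df.
have M0 := dual_norm_ge0 df; set M := dual_norm f in fy M0 *.
pose lfun : {linear X -> R^o} := HB.pack f (GRing.isLinear.Build _ _ _ _ f df.1).
exists (M *: y); rewrite /duality_map /=.
have -> : f (M *: y) = M *: f y := linearZ_LR lfun _ _.
rewrite -/M fy; split=> //; rewrite normrZ ger0_norm//.
have [->|MN0] := eqVneq M 0; first by rewrite mul0r.
have : M <= M * `|y| by rewrite -{1}fy (le_trans (ler_norm _))// dual_bound.
have Mp : 0 < M by rewrite lt_def MN0.
rewrite ler_pMr// => y1'.
suff -> : `|y| = 1 by rewrite mulr1.
by apply/eqP; rewrite eq_le y1.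
Qed.

End DualNorm.

(** * The least norm of a subgradient, descent directions and the C-condition *)

Section Slope.
Context {R : realType} {X : normedModType R}.
Variable J : X -> R^o.
Hypothesis lipJ : locally_lipschitz J.

Lemma subdifferential_nonempty x : subdifferential J x !=set0.
Proof.
have [f [lf fle]] := hahn_banach (clarke_sublinear lipJ x).
by exists f; exact: dual_subdifferentialP.
Qed.

Lemma subdifferential_le x f v : subdifferential J x f -> f v <= clarke J x v.
Proof. by move=> [_ /(_ v)]; rewrite clarkeE// lee_fin. Qed.

Lemma slope_le x f : subdifferential J x f -> slope J x <= dual_norm f.
Proof.
move=> Jf; apply: ge_inf; last by exists f.
by exists 0 => _ [g [dg _] <-]; exact: dual_norm_ge0.
Qed.

Lemma slope_ge0 x : 0 <= slope J x.
Proof.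
apply: lb_le_inf; last by move=> _ [g [dg _] <-]; exact: dual_norm_ge0.
by have [f Jf] := subdifferential_nonempty x; exists (dual_norm f), f.
Qed.

Lemma slope_lt x e : slope J x < e ->
  exists2 f, subdifferential J x f & dual_norm f < e.
Proof.
move=> xe; have [||_ [f Jf <-]] := @inf_adherent _
    [set dual_norm f | f in subdifferential J x] (e - slope J x).
- by rewrite subr_gt0.
- split; last by exists 0 => _ [g [dg _] <-]; exact: dual_norm_ge0.
  by have [f Jf] := subdifferential_nonempty x; exists (dual_norm f), f.
- by rewrite addrC subrK => fe; exists f.
Qed.

Lemma slope_eq0 x : subdifferential J x 0 -> slope J x = 0.
Proof.
move=> J0; apply/eqP; rewrite eq_le slope_ge0 andbT (le_trans (slope_le J0))//.
by apply: dual_norm_le => // y; rewrite normr0 mul0r.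
Qed.

(** If [clarke J u v] were negative, a uniform rate of decrease along [v] would persist at nearby
    base points and keep their subgradients away from zero. *)
Lemma slope_lsc0 u : (forall e : R, 0 < e ->
  exists2 z, `|z - u| < e & slope J z < e) -> subdifferential J u 0.
Proof.
move=> h; apply: dual_subdifferentialP => //.
  by move=> t v w; rewrite /= scaler0 addr0.
move=> v; suff : 0 <= clarke J u v by [].
rewrite leNgt; apply/negP => uv.
have [d d0 hd] : exists2 d : R, 0 < d & forall z t, `|z - u| < d ->
    0 < t < d -> J (z + t *: v) - J z <= clarke J u v / 2 * t.
  by apply: clarke_quotient => //; lra.
have v1 : 0 < 1 + `|v| by rewrite ltr_pwDl.
(* The first bound keeps the [d / 2] ball around [z] inside the [d] ball around [u]; the second
   makes the subgradient at [z] too small for the decrease along [v]. *)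
have [|z zu zs] := h (Num.min (d / 2) (- (clarke J u v / 2) / (1 + `|v|))).
  rewrite lt_min !divr_gt0//=; lra.
have [f Jf fe] := slope_lt zs.
have : clarke J z v <= clarke J u v / 2.
  apply: (@clarke_le _ _ _ lipJ _ _ _ (d / 2)); first by rewrite divr_gt0.
  move=> z' t zz' /andP[t0 td]; apply: hd; last by rewrite t0 /=; lra.
  move: zu; rewrite lt_min => /andP[zu _].
  have := ler_normD (z' - z) (z - u); rewrite addrA subrK; lra.
have := subdifferential_le v Jf; have := dual_bound v Jf.1.
have : dual_norm f * `|v| <= - (clarke J u v / 2) / (1 + `|v|) * `|v|.
  by rewrite ler_wpM2r// ltW// (lt_le_trans fe)// ge_min lexx orbT.
have : - (clarke J u v / 2) / (1 + `|v|) * `|v| < - (clarke J u v / 2).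
  rewrite mulrAC ltr_pdivrMr// ltr_pM2l ?ltrDr//; lra.
have := ler_norm (- f v); rewrite normrN; lra.
Qed.

(** An infimum equal to zero is attained: [slope_lsc0] with [z = x]. *)
Lemma critical_subdifferential x : slope J x = 0 -> subdifferential J x 0.
Proof. by move=> x0; apply: slope_lsc0 => e e0; exists x; rewrite ?subrr ?normr0 ?x0. Qed.

(* If no such direction existed, the sandwich form of Hahn-Banach would give a
   subgradient [f] above [- (slope / 2) |.|] on [C]; evaluated at minus an
   element of the duality map of [f], this forces [dual_norm f <= slope / 2]. *)
Lemma descent_direction x (C : set X) :
  reflexive_space X -> 0 < slope J x ->
  (forall v w t, 0 <= t <= 1 -> C v -> C w -> C (t *: v + (1 - t) *: w)) ->
  (forall y, set_gradient J x y -> C (- y)) ->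
  exists2 v, C v & clarke J x v < - (slope J x / 2 * `|v|).
Proof.
move=> refl m0 convC gradC; apply: contrapT => nex.
have pC v : C v -> - (slope J x / 2 * `|v|) <= clarke J x v.
  by move=> Cv; rewrite leNgt; apply/negP => h; apply: nex; exists v.
(* The cone over [C], lifted above [slope J x / 2] times the norm. A functional [f] with
   [0 <= f v + c] on [K] is at least minus that multiple of the norm on [C]. *)
pose K := [set z : X * R | slope J x / 2 * `|z.1| <= z.2 /\
  exists2 t : R, 0 <= t & exists2 v, C v & z.1 = t *: v].
have sp := clarke_sublinear lipJ x.
have cK : convex_cone K.
  split.
  - split; first by rewrite /= normr0 mulr0.
    (* [C] must be nonempty here; reflexivity supplies a duality image of some subgradient. *)
    have [f Jf] := subdifferential_nonempty x.
    have [y yf] := duality_map_nonempty refl Jf.1.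
    exists 0 => //; exists (- y); last by rewrite scale0r.
    by apply: gradC; exists f.
  - move=> a c b d [/= h1 [t t0 [v Cv aE]]] [/= h2 [s s0 [w Cw bE]]].
    split => /=.
      rewrite (le_trans _ (lerD h1 h2))// -mulrDr ler_wpM2l ?ler_normD//.
      by rewrite divr_ge0// ltW.
    exists (t + s); first exact: addr_ge0.
    rewrite aE bE.
    have [ts0|ts0] := eqVneq (t + s) 0.
      have -> : t = 0 by lra.
      have -> : s = 0 by lra.
      exists v; first by [].
      by rewrite !(addr0, scale0r).
    have ts : 0 < t + s by rewrite lt_def ts0 addr_ge0.
    exists ((t / (t + s)) *: v + (1 - t / (t + s)) *: w).
      apply: convC => //; rewrite divr_ge0 ?(ltW ts)//=.
      by rewrite ler_pdivrMr// mul1r lerDl.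
    rewrite scalerDr !scalerA mulrBr mulr1 mulrCA divff// mulr1.
    by rewrite [t + s]addrC addrK.
  - move=> t a c t0 [/= h [s s0 [v Cv aE]]]; split => /=.
      rewrite normrZ ger0_norm// mulrCA; exact: ler_wpM2l.
    by exists (t * s); [exact: mulr_ge0|exists v; rewrite ?aE ?scalerA].
have pK v c : K (v, c) -> 0 <= clarke J x v + c.
  move=> [/= h [t t0 [w Cw vE]]]; move: h; rewrite vE.
  rewrite normrZ ger0_norm// (sublinearZ _ sp)// => h.
  have := ler_wpM2l t0 (pC _ Cw); lra.
have [f [lf fle fK]] := mazur_orlicz sp cK pK.
have Jf := dual_subdifferentialP lipJ lf fle.
have [y yf] := duality_map_nonempty refl Jf.1.
have [fy fN] := yf.
have Cy : C (- y) by apply: gradC; exists f.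
have /fK : K (- y, slope J x / 2 * `|y|).
  split; first by rewrite /= normrN.
  by exists 1 => //; exists (- y); rewrite ?scale1r.
pose lfun : {linear X -> R^o} := HB.pack f (GRing.isLinear.Build _ _ _ _ f lf).
have -> : f (- y) = - f y := linearN lfun y.
have N0 := dual_norm_ge0 Jf.1.
have Ny : dual_norm f = `|y|.
  by apply/eqP; rewrite -(@eqrXn2 _ 2)//; apply/eqP.
have := slope_le Jf; rewrite fy Ny => mN.
have yp : 0 < `|y| by exact: lt_le_trans mN.
rewrite addrC subr_ge0 expr2 ler_pM2r//; lra.
Qed.

Lemma slope_on_setT_ge0 x : 0 <= slope_on J setT x.
Proof.
apply: lb_le_inf.
  have [f Jf] := subdifferential_nonempty x.
  by exists (sup [set f (x - y) | y in [set y | setT y /\ `|x - y| < 1]]), f.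
move=> _ [f [df _] <-]; apply: ub_le_sup.
  exists (dual_norm f) => _ [y [_ xy] <-]; rewrite (le_trans (ler_norm _))//.
  by rewrite (le_trans (dual_bound _ df))// ler_piMr ?dual_norm_ge0 ?ltW.
exists x; first by rewrite /= subrr normr0.
pose lfun : {linear X -> R^o} := HB.pack f (GRing.isLinear.Build _ _ _ _ f df.1).
rewrite subrr; exact: linear0 lfun.
Qed.

(** A supremum over an open unit ball is at most the dual norm; so smallness of [slope] triggers the
    C-condition. *)
Lemma slope_on_setT_le x : slope_on J setT x <= slope J x.
Proof.
apply: lb_le_inf.
  by have [f Jf] := subdifferential_nonempty x; exists (dual_norm f), f.
move=> _ [f Jf <-].
have df := Jf.1; have supf : sup [set f (x - y) | y in [set y | setT y /\ `|x - y| < 1]]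
    <= dual_norm f.
  apply: ge_sup.
    by exists (f (x - x)), x => //=; rewrite subrr normr0.
  move=> _ [y [_ xy] <-]; rewrite (le_trans (ler_norm _))//.
  by rewrite (le_trans (dual_bound _ df))// ler_piMr ?dual_norm_ge0 ?ltW.
apply: le_trans supf; apply: ge_inf; last by exists f.
exists 0 => _ [g [dg _] <-]; apply: ub_le_sup.
  exists (dual_norm g) => _ [y [_ xy] <-]; rewrite (le_trans (ler_norm _))//.
  by rewrite (le_trans (dual_bound _ dg))// ler_piMr ?dual_norm_ge0 ?ltW.
exists x; first by rewrite /= subrr normr0.
pose lfun : {linear X -> R^o} := HB.pack g (GRing.isLinear.Build _ _ _ _ g dg.1).
rewrite subrr; exact: linear0 lfun.
Qed.

Hypothesis condC : C_condition J setT setT.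

(** The limit [v] is critical by [slope_lsc0] and at level [r] by continuity. The last clause speaks
    of arbitrarily late indices, which spares carrying the subsequence. *)
Lemma C_condition_subsequence (r : R) (u : nat -> X) :
  (forall n, `|J (u n) - r| < n.+1%:R^-1) ->
  (forall n, (1 + `|u n|) * slope J (u n) < n.+1%:R^-1) ->
  exists v, [/\ subdifferential J v 0, J v = r &
    forall e (N : nat), 0 < e -> exists2 n, (N <= n)%N & `|u n - v| < e].
Proof.
move=> hJ hs.
have cJ : J (u n) @[n --> \oo] --> r.
  apply/cvgrPdist_lt => e e0; near=> n.
  rewrite distrC (lt_trans (hJ n))//; near: n; exact: near_infty_natSinv_lt (PosNum e0).
have cs : (1 + `|u n|) * slope_on J setT (u n) @[n --> \oo] --> 0.
  apply/cvgrPdist_lt => e e0; near=> n.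
  have u1 : 0 <= 1 + `|u n| by rewrite addr_ge0.
  rewrite sub0r normrN ger0_norm ?mulr_ge0 ?slope_on_setT_ge0//.
  rewrite (le_lt_trans (ler_wpM2l u1 (slope_on_setT_le _)))// (lt_trans (hs n))//.
  near: n; exact: near_infty_natSinv_lt (PosNum e0).
have [phi [phi_homo uphi]] := condC (u := u) (fun=> I) (ex_intro _ r cJ) cs.
have phi_ge n : (n <= phi n)%N.
  by elim: n => // n IH; rewrite (leq_ltn_trans IH)// phi_homo.
pose v := limn (u \o phi).
have cv : (u \o phi) n @[n --> \oo] --> v by [].
have near_v e (N : nat) : 0 < e -> exists2 n, (N <= n)%N & `|u n - v| < e.
  move=> e0; near \oo => n; exists (phi n).
    by rewrite (leq_trans _ (phi_ge n))//; near: n; exists N.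
  by rewrite distrC; near: n; move/cvgrPdist_lt : cv; apply.
exists v; split => //.
  apply: slope_lsc0 => e e0; near \oo => N.
  have [n Nn un] := near_v _ N e0; exists (u n) => //.
  apply: (@le_lt_trans _ _ ((1 + `|u n|) * slope J (u n))).
    by rewrite ler_peMl ?slope_ge0// lerDl.
  rewrite (lt_le_trans (hs n))// (@le_trans _ _ N.+1%:R^-1)//.
    by rewrite lef_pV2 ?posrE// ler_nat ltnS.
  by rewrite ltW//; near: N; exact: near_infty_natSinv_lt (PosNum e0).
have c1 : J ((u \o phi) n) @[n --> \oo] --> J v.
  apply: continuous_cvg => //; exact: locally_lipschitz_continuous.
have c2 : J ((u \o phi) n) @[n --> \oo] --> r.
  apply/cvgrPdist_lt => e e0; near=> n.
  rewrite distrC (lt_le_trans (hJ _))// (@le_trans _ _ n.+1%:R^-1)//.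
    by rewrite lef_pV2 ?posrE// ler_nat ltnS.
  by rewrite ltW//; near: n; exact: near_infty_natSinv_lt (PosNum e0).
exact: (cvg_unique _ c1 c2).
Unshelve. all: by end_near. Qed.

(** Along critical points the weighted slope is zero whatever their norms, so an unbounded sequence
    of them would have a cluster point. *)
Lemma critical_level_bounded r :
  exists M : R, forall k, critical_level J r k -> `|k| <= M.
Proof.
apply: contrapT => nM.
have /choice[u hu] n : exists k, critical_level J r k /\ n%:R < `|k|.
  apply: contrapT => nk; apply: nM; exists n%:R => k rk.
  by rewrite leNgt; apply/negP => h; apply: nk; exists k.
have [||v [_ _ uv]] := @C_condition_subsequence r u.
- by move=> n; have [[_ ->] _] := hu n; rewrite subrr normr0 invr_gt0.
- by move=> n; have [[-> _] _] := hu n; rewrite mulr0 invr_gt0.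
have [n Nn un] := uv 1 (Num.bound (`|v| + 1)) ltr01.
have := archi_boundP (addr_ge0 (normr_ge0 v) ler01).
have : (Num.bound (`|v| + 1))%:R <= n%:R :> R by rewrite ler_nat.
have [_ ] := hu n; have := ler_normD (u n - v) v; rewrite subrK.
set b := _%:R; lra.
Qed.

(** Otherwise a sequence in [G] with levels tending to [r] and weighted slopes tending to zero would
    cluster at a critical point of the closed set [G]. *)
Lemma slope_lower_bound (G : set X) r : closed G ->
  (forall x, G x -> ~ critical_level J r x) ->
  exists2 e : R, 0 < e & exists2 s : R, 0 < s &
    forall x, G x -> `|J x - r| < e -> s <= (1 + `|x|) * slope J x.
Proof.
move=> cG Gr; apply: contrapT => nex.
have /choice[u hu] n : exists x, [/\ G x, `|J x - r| < n.+1%:R^-1 &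
    (1 + `|x|) * slope J x < n.+1%:R^-1].
  apply: contrapT => nx; apply: nex; exists n.+1%:R^-1; first by rewrite invr_gt0.
  exists n.+1%:R^-1; first by rewrite invr_gt0.
  move=> x Gx xr; rewrite leNgt; apply/negP => h; apply: nx; exists x; split => //.
have [||v [Jv vr uv]] := @C_condition_subsequence r u.
- by move=> n; have [] := hu n.
- by move=> n; have [] := hu n.
apply: (Gr v); last by split => //; exact: slope_eq0.
apply: cG => B /nbhs_ballP[e /= e0 eB].
have [n _ un] := uv e 0%N e0; exists (u n); split; first by have [] := hu n.
by apply: eB; rewrite -ball_normE /= distrC.
Qed.

End Slope.

(** * Metric neighbourhoods of convex sets and inward directions *)

Section Neighborhoods.
Context {R : realType} {X : normedModType R}.
Implicit Types (A Q P : set X) (mu rho : R).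

Lemma open_nbhdP A rho x :
  open_nbhd A rho x <-> exists2 a, A a & `|x - a| < rho.
Proof.
split=> [/ereal_inf_lt[_ [a Aa <-]] /edist_lt_ball|[a Aa xa]].
  by rewrite -ball_normE /=; exists a.
apply: (@le_lt_trans _ _ (edist (x, a))); first by apply: ereal_inf_lbound; exists a.
apply: (@le_lt_trans _ _ ((`|x - a| + (rho - `|x - a|) / 2)%:E)); last first.
  by rewrite lte_fin; lra.
have r0 : 0 < `|x - a| + (rho - `|x - a|) / 2.
  by rewrite ltr_wpDl// divr_gt0// subr_gt0.
apply: edist_fin => //; rewrite -ball_normE /=; lra.
Qed.

Lemma closed_nbhdP A mu x :
  closed_nbhd A mu x <->
  forall e, 0 < e -> exists2 a, A a & `|x - a| < mu + e.
Proof.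
split=> [xA e e0|h].
  by apply/open_nbhdP; rewrite /open_nbhd /= (le_lt_trans xA)// lte_fin ltrDl.
apply/lee_addgt0Pr => e e0; rewrite -EFinD; apply/ltW.
by apply/open_nbhdP; exact: h.
Qed.

Lemma closed_closed_nbhd A mu : closed (closed_nbhd A mu).
Proof.
move=> x xA; apply/closed_nbhdP => e e0.
have e2 : 0 < e / 2 by rewrite divr_gt0.
have [z [/closed_nbhdP/(_ _ e2)[a Aa za]]] := xA _ (nbhsx_ballx x _ e2).
rewrite -ball_normE /= => xz; exists a => //.
have := ler_normD (x - z) (z - a); rewrite addrA subrK; lra.
Qed.

Lemma closed_nbhd_shift A mu x z : closed_nbhd A mu x ->
  closed_nbhd A (mu + `|z|) (x + z).
Proof.
move=> /closed_nbhdP h; apply/closed_nbhdP => e /h[a Aa xa]; exists a => //.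
have := ler_normD (x - a) z; rewrite addrAC; lra.
Qed.

Lemma closed_nbhd_le A mu nu : mu <= nu -> closed_nbhd A mu `<=` closed_nbhd A nu.
Proof.
move=> mn x /closed_nbhdP h; apply/closed_nbhdP => e /h[a Aa xa].
by exists a => //; lra.
Qed.

Lemma closed_nbhd_interior A mu nu : mu < nu ->
  closed_nbhd A mu `<=` (closed_nbhd A nu)°.
Proof.
move=> mn x xA; apply/nbhs_ballP; exists (nu - mu) => /=; first by rewrite subr_gt0.
move=> y; rewrite -ball_normE /= => xy.
have := closed_nbhd_shift (y - x) xA; rewrite [x + _]addrC subrK.
by apply: closed_nbhd_le; rewrite distrC; lra.
Qed.

Lemma sub_closed_nbhd A mu : 0 <= mu -> A `<=` closed_nbhd A mu.
Proof.
by move=> mu0 x Ax; apply/closed_nbhdP => e e0; exists x; rewrite ?subrr ?normr0//; lra.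
Qed.

Lemma closed_nbhd_opp P mu x :
  closed_nbhd [set - y | y in P] mu (- x) <-> closed_nbhd P mu x.
Proof.
split=> /closed_nbhdP h; apply/closed_nbhdP => e /h[].
  by move=> _ [p Pp <-] xp; exists p => //; rewrite -normrN opprD.
by move=> p Pp xp; exists (- p); [exists p|rewrite -normrN opprB opprK addrC].
Qed.

Definition convex Q :=
  forall v w t, 0 <= t <= 1 -> Q v -> Q w -> Q (t *: v + (1 - t) *: w).

Lemma convex_closed_nbhd Q mu : convex Q -> convex (closed_nbhd Q mu).
Proof.
move=> cQ v w t t01 /closed_nbhdP vQ /closed_nbhdP wQ; apply/closed_nbhdP => e e0.
have [a Qa va] := vQ e e0; have [b Qb wb] := wQ e e0.
have /andP[t0 t1] := t01.
exists (t *: a + (1 - t) *: b); first exact: cQ.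
rewrite opprD addrACA -!scalerBr (le_lt_trans (ler_normD _ _))//.
rewrite !normrZ ger0_norm// [ `|1 - t| ]ger0_norm ?subr_ge0//.
have [->|tN0] := eqVneq t 0; first by rewrite mul0r subr0 mul1r add0r.
have tp : 0 < t by rewrite lt_def tN0.
have h1 : t * `|v - a| < t * (mu + e) by rewrite ltr_pM2l.
have h2 : (1 - t) * `|w - b| <= (1 - t) * (mu + e).
  by rewrite ler_wpM2l ?subr_ge0// ltW.
lra.
Qed.

Lemma is_cone_convex P : is_cone P -> convex P.
Proof.
move=> [_ cP _ _] v w t /andP[t0 t1] Pv Pw.
by have := cP v w (Itv01 t0 t1); rewrite !inE; apply.
Qed.

Lemma is_cone0 P : is_cone P -> P 0.
Proof.
by move=> [_ _ _ PP]; have [] : (P `&` [set - x | x in P]) 0 by rewrite PP.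
Qed.

Lemma convex_opp P : convex P -> convex [set - x | x in P].
Proof.
move=> cP _ _ t t01 [v Pv <-] [w Pw <-].
by exists (t *: v + (1 - t) *: w); [exact: cP|rewrite opprD -!scalerN].
Qed.

(** If [a] is outside the closed neighbourhood, so are all nearby points. Otherwise [a] is on the
    boundary, and the margin [mu / 2] at [a + v] absorbs [z - a]; the segment from [z] to [z + v]
    then stays inside by convexity. *)
Lemma inward_ball Q mu a v : convex Q -> 0 < mu ->
  (boundary (closed_nbhd Q mu) a -> closed_nbhd Q (mu / 2) (a + v)) ->
  ~ (closed_nbhd Q mu)° a -> 0 < `|v| ->
  exists2 rho : R, 0 < rho & forall z t, `|z - a| < rho -> 0 <= t <= rho ->
    closed_nbhd Q mu z -> closed_nbhd Q mu (z + t *: (`|v|^-1 *: v)).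
Proof.
move=> cQ mu0 av aD v0; have [aQ|aQ] := pselect (closed_nbhd Q mu a).
  have {}av : closed_nbhd Q (mu / 2) (a + v).
    by apply: av; split => //; exact: subset_closure.
  exists (Num.min `|v| (mu / 2)); first by rewrite lt_min v0 divr_gt0.
  move=> z t; rewrite lt_min le_min => /andP[_ za] /and3P[t0 tv _] zQ.
  have zv : closed_nbhd Q mu (z + v).
    have := closed_nbhd_shift (z - a) av.
    rewrite [a + v]addrC -addrA [a + _]addrC subrK [v + z]addrC.
    by apply: closed_nbhd_le; lra.
  have t1 : 0 <= t / `|v| <= 1 by rewrite divr_ge0//= ler_pdivrMr// mul1r.
  have := convex_closed_nbhd (mu := mu) cQ t1 zv zQ.
  rewrite scalerDr addrAC -scalerDl [t / _ + _]addrC subrK scale1r scalerA.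
  by [].
have /nbhs_ballP[e /= e0 ea] : nbhs a (~` closed_nbhd Q mu).
  by apply: open_nbhs_nbhs; split => //; rewrite openC; exact: closed_closed_nbhd.
exists e => // z t za _ zQ; exfalso; apply: (ea z) => //.
by rewrite -ball_normE /= distrC.
Qed.

End Neighborhoods.

(** * Lipschitz pushes along one direction per cell of a cover *)

Section DisjointPush.
Context {R : realType} {X : normedModType R}.
Variables (W : set X) (rho : X -> R) (v : X -> X) (ev : Prop).
Hypothesis rhoW : forall a, W a -> 0 < rho a <= `|a|.
Hypothesis normv : forall a, W a -> `|v a| = 1.

Definition cell_sign (s : R) := s = 1 \/ (ev /\ s = -1).

Definition cell a (s : R) : set X := [set z | `|z - s *: a| < rho a].

Lemma cell_sign_norm s : cell_sign s -> `|s| = 1.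
Proof. by case=> [->|[_ ->]]; rewrite ?normrN normr1. Qed.

Lemma cell_opp a s z : cell a s z -> cell a (- s) (- z).
Proof. by rewrite /cell /= scaleNr -opprD normrN. Qed.

(** Since [rho a <= |a|], the balls around [a] and [- a] are disjoint. *)
Lemma cell_sign_inj a s s' z : W a -> cell_sign s -> cell_sign s' ->
  cell a s z -> cell a s' z -> s = s'.
Proof.
have disj b y : W b -> cell b 1 y -> cell b (-1) y -> False.
  move=> /rhoW/andP[_ rb]; rewrite /cell /= scale1r scaleN1r opprK => h1 h2.
  have := ler_normD (y + b) (b - y); rewrite addrC addrA subrK -mulr2n.
  by rewrite normrMn mulr2n [ `|b - y| ]distrC; lra.
move=> Wa [->|[_ ->]] [->|[_ ->]] // h1 h2; exfalso.
  exact: disj h1 h2.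
exact: disj h2 h1.
Qed.

(* A. H. Stone's theorem in the form given by M. E. Rudin's proof: points that
   are [3 tau]-deep in the first cell containing them fall into families that
   are [3 tau] apart, so that one direction per family can be followed. *)
Lemma separated_push : exists g : R -> X -> X,
  [/\ (forall tau x y, 0 < tau -> `|g tau x - g tau y| <= 2 * `|x - y|),
      (forall tau x, 0 < tau -> g tau x != 0 -> exists t a s,
         [/\ 0 < t <= tau, W a, cell_sign s, g tau x = t *: (s *: v a) &
             forall z, `|z - x| < 2 * tau -> cell a s z]),
      (forall x, W x -> exists2 tau0 : R, 0 < tau0 &
         forall tau, 0 < tau < tau0 -> g tau x != 0) &
      (ev -> forall tau x, 0 < tau -> g tau (- x) = - g tau x)].
Proof.
have [le le_wo] := wochoice.well_ordering_principle X.
pose cells x := [set b | W b /\ exists2 s, cell_sign s & cell b s x].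
have le_min (A : set X) : A !=set0 -> exists2 a, A a & forall b, A b -> le a b.
  move=> [a Aa]; have [|c [[cA clb] _]] := le_wo (fun b => `[< A b >]).
    by exists a; apply/asboolP.
  exists c; first by apply/asboolP.
  by move=> b Ab; apply: clb; apply/asboolP.
(* Antisymmetry comes from uniqueness of the least element of a pair. *)
have le_anti a b : le a b -> le b a -> a = b.
  move=> ab ba.
  have le_refl c : le c c.
    have [d dc h] := le_min [set c] (ex_intro _ c erefl).
    by have := h c erefl; rewrite dc.
  have [|c [_ cu]] := le_wo (pred2 a b); first by exists a; rewrite inE eqxx.
  have cE d : le d a -> le d b -> d \in pred2 a b -> c = d.
    move=> da db dab; apply: cu; split=> // x.
    by rewrite !inE => /orP[/eqP->|/eqP->].
  rewrite -(cE a (le_refl a) ab); last by rewrite !inE eqxx.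
  by apply: cE; rewrite ?inE ?eqxx ?orbT.
(* The deep points: [a] indexes the first cell containing [p], up to sign, and the [3 * tau] ball
   around [p] stays in it. *)
pose S tau p a s := [/\ cell_sign s, W a, (forall b, cells p b -> le a b) &
  forall z, `|z - p| < 3 * tau -> cell a s z].
have S_self tau p a s : 0 < tau -> S tau p a s -> cells p a.
  move=> tau0 [ss Wa _ h]; split => //; exists s => //.
  by apply: h; rewrite subrr normr0 mulr_gt0.
(* Each of two close deep points lies in the cell of the other, so minimality applies both ways. *)
have S_uniq tau p a s q b t : 0 < tau -> S tau p a s -> S tau q b t ->
    `|p - q| < 3 * tau -> a = b /\ s = t.
  move=> tau0 Sp Sq pq; have [ss Wa amin ha] := Sp; have [st Wb bmin hb] := Sq.
  have ab : a = b.
    apply: le_anti.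
      by apply: amin; split => //; exists t => //; exact: hb.
    by apply: bmin; split => //; exists s => //; apply: ha; rewrite distrC.
  split=> //; subst b; apply: (cell_sign_inj Wa ss st (z := q)).
    by apply: ha; rewrite distrC.
  by apply: hb; rewrite subrr normr0 mulr_gt0.
have S_opp tau p a s : ev -> S tau p a s -> S tau (- p) a (- s).
  have sN u : ev -> cell_sign u -> cell_sign (- u).
    by move=> e [->|[_ ->]]; [right|left; rewrite opprK].
  move=> e [ss Wa amin h]; split=> // [||z zp].
  - exact: sN.
  - move=> b [Wb [t st tb]]; apply: amin; split => //; exists (- t); first exact: sN.
    by have := cell_opp tb; rewrite opprK.
  - by rewrite -[z]opprK; apply: cell_opp; apply: h; rewrite -normrN opprD opprK.
pose near_S tau x := [set z : X * X * R | S tau z.1.1 z.1.2 z.2 /\ `|x - z.1.1| < tau].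
(* A tent of height [tau] over the deep points, 1-Lipschitz; the added [0] is its value away from
   them. *)
pose phi tau x := sup ([set 0] `|` [set tau - `|x - z.1.1| | z in near_S tau x]).
(* The choice is harmless: deep points within [tau] of [x] share cell and sign by [S_uniq]. *)
pose w tau x := xget 0 [set z.2 *: v z.1.2 | z in near_S tau x].
have phi_ub tau x : 0 < tau ->
    ubound ([set 0] `|` [set tau - `|x - z.1.1| | z in near_S tau x]) tau.
  move=> tau0 _ [->|[z _ <-]]; first exact: ltW.
  by rewrite lerBlDr lerDl.
have phi_ge tau x p a s : 0 < tau -> S tau p a s -> tau - `|x - p| <= phi tau x.
  move=> tau0 Sp; have [xp|xp] := ltP `|x - p| tau.
    apply: ub_le_sup; first by exists tau; exact: phi_ub.
    by right; exists (p, a, s).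
  apply: (@le_trans _ _ 0); first by rewrite subr_le0.
  by apply: ub_le_sup; [exists tau; exact: phi_ub|left].
have phi_ge0 tau x : 0 < tau -> 0 <= phi tau x.
  by move=> tau0; apply: ub_le_sup; [exists tau; exact: phi_ub|left].
have phi_le tau x : 0 < tau -> phi tau x <= tau.
  by move=> tau0; apply: ge_sup; [exists 0; left|exact: phi_ub].
have phi_lip tau x y : 0 < tau -> phi tau x <= phi tau y + `|x - y|.
  move=> tau0; apply: ge_sup; first by exists 0; left.
  move=> _ [->|[[[p a] s] [/= Sp _] <-]]; first by rewrite addr_ge0 ?phi_ge0.
  have := phi_ge tau y p a s tau0 Sp; have := ler_normD (y - x) (x - p).
  by rewrite addrA subrK [ `|y - x| ]distrC; lra.
have phi_gt0 tau x : 0 < tau -> 0 < phi tau x -> near_S tau x !=set0.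
  move=> tau0 px; apply: contrapT => /nonemptyPn near0; move: px.
  by rewrite /phi near0 image_set0 setU0 sup1 ltxx.
have w_near tau x : near_S tau x !=set0 -> exists p a s,
    [/\ S tau p a s, `|x - p| < tau & w tau x = s *: v a].
  move=> [z zx]; rewrite /w; case: xgetP => [y _ [[[p a] s] [/= Sp xp] <-]|].
    by exists p, a, s.
  by move=> /(_ (z.2 *: v z.1.2)) []; exists z.
have w_norm tau x : 0 < tau -> near_S tau x !=set0 -> `|w tau x| = 1.
  move=> tau0 /w_near[p [a [s [[ss Wa _ _] _ ->]]]].
  by rewrite normrZ cell_sign_norm// normv// mulr1.
exists (fun tau x => phi tau x *: w tau x); split.
- move=> tau x y tau0.
  have xy0 : 0 <= `|x - y| by [].
  have px0 := phi_ge0 tau x tau0; have py0 := phi_ge0 tau y tau0.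
  have [pxE|pxN] := eqVneq (phi tau x) 0.
    rewrite pxE scale0r sub0r normrN.
    have [->|pyN] := eqVneq (phi tau y) 0; first by rewrite scale0r normr0 mulr_ge0.
    have py : 0 < phi tau y by rewrite lt_def pyN.
    rewrite normrZ w_norm ?mulr1 ?ger0_norm//; last exact: phi_gt0.
    by have := phi_lip tau y x tau0; rewrite distrC pxE; lra.
  have px : 0 < phi tau x by rewrite lt_def pxN.
  have nx := phi_gt0 _ _ tau0 px.
  have [pyE|pyN] := eqVneq (phi tau y) 0.
    rewrite pyE scale0r subr0 normrZ w_norm// mulr1 ger0_norm//.
    by have := phi_lip tau x y tau0; rewrite pyE; lra.
  have py : 0 < phi tau y by rewrite lt_def pyN.
  have ny := phi_gt0 _ _ tau0 py.
  have [p [a [s [Sp xp wx]]]] := w_near _ _ nx.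
  have [q [b [t [Sq yq wy]]]] := w_near _ _ ny.
  have [pq|pq] := ltP `|p - q| (3 * tau).
    have [ab st] := S_uniq _ _ _ _ _ _ _ tau0 Sp Sq pq.
    rewrite wx wy -ab -st -scalerBl normrZ -wx w_norm// mulr1.
    apply: (@le_trans _ _ `|x - y|); last by lra.
    have := phi_lip tau x y tau0; have := phi_lip tau y x tau0.
    by rewrite [ `|y - x| ]distrC ler_norml; lra.
  (* Here [p] and [q] are at least [3 * tau] apart, so [x] and [y] are more than [tau] apart, while
     both values have norm at most [tau]. This case yields the constant 2. *)
  have := ler_normB (phi tau x *: w tau x) (phi tau y *: w tau y).
  rewrite !normrZ !w_norm// !mulr1 !ger0_norm// => h.
  have := phi_le tau x tau0; have := phi_le tau y tau0.
  have := ler_normD (p - x) (x - y + (y - q)); have := ler_normD (x - y) (y - q).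
  by rewrite !addrA !subrK [ `|p - x| ]distrC; lra.
- move=> tau x tau0; rewrite scaler_eq0 negb_or => /andP[pN _].
  have px : 0 < phi tau x by rewrite lt_def pN phi_ge0.
  have [p [a [s [[ss Wa amin h] xp ->]]]] := w_near _ _ (phi_gt0 _ _ tau0 px).
  exists (phi tau x), a, s; split => //; first by rewrite px phi_le.
  move=> z zx; apply: h; have := ler_normD (z - x) (x - p).
  by rewrite addrA subrK; lra.
- move=> x Wx; have x0 : cells x x.
    split=> //; exists 1; first by left.
    by rewrite /cell /= scale1r subrr normr0; have /andP[] := rhoW Wx.
  have [a [Wa [s ss xa]] amin] := le_min (cells x) (ex_intro _ x x0).
  (* A third of the depth of [x] in its first cell: below it, [x] is itself a deep point. *)
  exists ((rho a - `|x - s *: a|) / 3); first by rewrite divr_gt0// subr_gt0.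
  move=> tau /andP[tau0 tault].
  have Sx : S tau x a s.
    split=> // z zx; rewrite /cell /=; have := ler_normD (z - x) (x - s *: a).
    by rewrite addrA subrK; lra.
  have nS : near_S tau x !=set0.
    by exists (x, a, s); split; rewrite //= subrr normr0.
  rewrite scaler_eq0 negb_or; apply/andP; split.
    rewrite gt_eqF// (lt_le_trans tau0)//.
    by have := phi_ge tau x x a s tau0 Sx; rewrite subrr normr0 subr0.
  by rewrite -normr_gt0 w_norm.
- move=> e tau x tau0.
  have nearN y z : near_S tau y z -> near_S tau (- y) (- z.1.1, z.1.2, - z.2).
    move=> [Sz yz]; split => /=; first exact: S_opp.
    by rewrite -opprD normrN.
  have phiN y : phi tau y <= phi tau (- y).
    apply: ge_sup; first by exists 0; left.
    move=> _ [->|[z [Sz _] <-]]; first exact: phi_ge0.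
    have := phi_ge tau (- y) _ _ _ tau0 (S_opp _ _ _ _ e Sz).
    by rewrite -opprD normrN.
  have phiE : phi tau (- x) = phi tau x.
    apply/eqP; rewrite eq_le phiN andbT.
    by have := phiN (- x); rewrite opprK.
  rewrite phiE; have [->|pN] := eqVneq (phi tau x) 0; first by rewrite !scale0r oppr0.
  have px : 0 < phi tau x by rewrite lt_def pN phi_ge0.
  have nx := phi_gt0 _ _ tau0 px.
  have [p [a [s [Sp xp ->]]]] := w_near _ _ nx.
  have nNx : near_S tau (- x) !=set0 by have [z /nearN] := nx; eexists; eassumption.
  have [q [b [t [Sq xq ->]]]] := w_near _ _ nNx.
  (* The mirror image of the deep point near [x] and the one chosen near [- x] are less than
     [2 * tau] apart. *)
  have [|-> <-] := S_uniq _ _ _ _ _ _ _ tau0 (S_opp _ _ _ _ e Sp) Sq.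
    have := ler_normD (- p + x) (- x - q); rewrite addrA addrK.
    by rewrite [- p + x]addrC; lra.
  by rewrite scaleNr scalerN.
Qed.

End DisjointPush.

(** * Isotopies given by small Lipschitz perturbations of the identity, and their concatenation *)

Section Deformation.
Context {R : realType} {X : completeNormedModType R}.

Lemma lipschitz_continuous (V Y : normedModType R) (f : V -> Y) (k : R) :
  (forall x y, `|f x - f y| <= k * `|x - y|) -> continuous f.
Proof.
move=> fk x; apply/cvgrPdist_lt => e e0; near=> y.
have k0 : 0 < `|k| + 1 by rewrite ltr_wpDl.
have xy : `|x - y| < e / (`|k| + 1).
  near: y; apply/nbhs_ballP; exists (e / (`|k| + 1)) => /=; first by rewrite divr_gt0.
  by move=> z; rewrite -ball_normE.
rewrite (le_lt_trans (fk x y))//.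
apply: (@le_lt_trans _ _ ((`|k| + 1) * `|x - y|)).
  by rewrite ler_wpM2r// (le_trans (ler_norm k))// lerDl.
by rewrite mulrC -ltr_pdivlMr.
Unshelve. all: by end_near. Qed.

(** The equation [x + g x = y] is solved by the fixed point of the contraction [y - g x]; the
    inverse is 2-Lipschitz. *)
Lemma lipschitz_perturbation_homeomorphism (g : X -> X) :
  (forall x y, `|g x - g y| <= 1 / 2 * `|x - y|) ->
  homeomorphism (fun x => x + g x).
Proof.
move=> hg.
have inv_lip x y : `|x - y| <= 2 * `|(x + g x) - (y + g y)|.
  have := ler_normB ((x + g x) - (y + g y)) (g x - g y).
  rewrite opprD addrACA addrK; have := hg x y; lra.
have /choice[h hh] y : exists x, x + g x = y.
  pose T x := y - g x.
  have TT : {homo T : x / setT x >-> setT x} by [].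
  pose F : {fun setT >-> setT} := mkfun TT.
  have cF : is_contraction F.
    exists (1 / 2)%:nng; split; first by rewrite /=; lra.
    by move=> [a b] _ /=; rewrite /T opprB addrC addrA subrK distrC.
  have [x _ xE] := banach_fixed_point cF closedT (ex_intro _ 0 I).
  by exists x; rewrite {1}xE /= /T subrK.
have inj x y : x + g x = y + g y -> x = y.
  move=> xy; apply/eqP; rewrite -subr_eq0 -normr_le0.
  by rewrite (le_trans (inv_lip x y))// xy subrr normr0 mulr0.
exists h; split=> //.
- by move=> x; apply: inj; rewrite hh.
- apply: (@lipschitz_continuous _ _ _ (3 / 2)) => x y.
  rewrite opprD addrACA (le_trans (ler_normD _ _))//.
  have := hg x y; lra.
- apply: (@lipschitz_continuous _ _ _ 2) => x y.
  by have := inv_lip (h x) (h y); rewrite !hh.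
Qed.

Lemma continuous_pair (T A B : topologicalType) (f : T -> A) (g : T -> B) :
  continuous f -> continuous g -> continuous (fun x => (f x, g x)).
Proof. by move=> cf cg x; exact: (cvg_pair (cf x) (cg x)). Qed.

Definition clamp (t : R) : R := Num.max 0 (Num.min t 1).

Lemma clamp_itv t : 0 <= clamp t <= 1.
Proof. by rewrite /clamp le_max lexx ge_max ler01 ge_min lexx orbT. Qed.

Lemma clamp_le s t : s <= t -> clamp s <= clamp t.
Proof.
by move=> st; rewrite /clamp ge_max !le_max lexx /= le_min !ge_min st lexx !orbT.
Qed.

Lemma clamp_eq0 t : t <= 0 -> clamp t = 0.
Proof. by move=> t0; rewrite /clamp max_l// ge_min t0. Qed.

Lemma clamp_eq1 t : 1 <= t -> clamp t = 1.
Proof. by move=> t1; rewrite /clamp min_r// max_r. Qed.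

Lemma clamp_continuous : continuous clamp.
Proof.
move=> t; apply: (@continuous_max R R (fun=> 0) (fun t => Num.min t 1)).
  exact: cvg_cst.
apply: (@continuous_min R R id (fun=> 1)); first exact: cvg_id.
exact: cvg_cst.
Qed.

Variables (J : X -> R) (Z D1 D2 : set X) (ev : Prop).

(** The properties that survive concatenation. Continuity is required for all real times, the
    remaining clauses only on the unit interval. *)
Definition deformation (eta : R -> X -> X) : Prop :=
  [/\ continuous (fun tu : R * X => eta tu.1 tu.2),
      (forall t u, 0 <= t <= 1 -> t = 0 \/ ~ Z u -> eta t u = u),
      (forall t, 0 <= t <= 1 -> homeomorphism (eta t)),
      (forall u s t, 0 <= s -> s <= t -> t <= 1 -> J (eta t u) <= J (eta s u)) &
      (forall t u, 0 <= t <= 1 ->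
         [/\ D1 u -> D1 (eta t u), D2 u -> D2 (eta t u) &
             ev -> eta t (- u) = - eta t u])].

Lemma deformation_id : deformation (fun _ u => u).
Proof.
split=> //; first by move=> [t u]; exact: cvg_snd.
by move=> t _; exists id; split=> // x; exact: cvg_id.
Qed.

Lemma homeomorphism_comp (f g : X -> X) :
  homeomorphism f -> homeomorphism g -> homeomorphism (g \o f).
Proof.
move=> [f' [fK f'K cf cf']] [g' [gK g'K cg cg']]; exists (f' \o g').
split.
- exact: can_comp gK fK.
- exact: can_comp f'K g'K.
- by move=> x; apply: continuous_comp; [exact: cf|exact: cg].
- by move=> x; apply: continuous_comp; [exact: cg'|exact: cf'].
Qed.

(** [eta1] runs on the first half of the interval and [eta2] on the second; [clamp] freezes
    whichever is inactive. *)
Lemma deformation_concat eta1 eta2 : deformation eta1 -> deformation eta2 ->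
  exists2 eta, deformation eta & eta 1 = eta2 1 \o eta1 1.
Proof.
move=> [c1 i1 h1 m1 p1] [c2 i2 h2 m2 p2].
exists (fun t => eta2 (clamp (2 * t - 1)) \o eta1 (clamp (2 * t))); last first.
  by rewrite !clamp_eq1//; lra.
have cl1 t := clamp_itv (2 * t); have cl2 t := clamp_itv (2 * t - 1).
split.
- have cm (a b : R) : continuous (fun tu : R * X => clamp (a * tu.1 + b)).
    move=> tu; apply: (@continuous_comp _ _ _ (fun tu : R * X => a * tu.1 + b) clamp);
      last exact: clamp_continuous.
    by apply: cvgD; [apply: cvgMl_tmp; exact: cvg_fst|exact: cvg_cst].
  have k1 : continuous (fun tu : R * X => eta1 (clamp (2 * tu.1)) tu.2).
    move=> tu; apply: (@continuous_comp _ _ _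
      (fun tu : R * X => (clamp (2 * tu.1), tu.2))
      (fun tu : R * X => eta1 tu.1 tu.2)); last exact: c1.
    apply: continuous_pair => [x|x]; last exact: cvg_snd.
    by have := cm 2 0 x; under [X in continuous_at _ X]eq_fun do rewrite addr0.
  move=> tu; apply: (@continuous_comp _ _ _
    (fun tu : R * X => (clamp (2 * tu.1 - 1), eta1 (clamp (2 * tu.1)) tu.2))
    (fun tu : R * X => eta2 tu.1 tu.2)); last exact: c2.
  by apply: continuous_pair; [exact: (cm 2 (-1))|exact: k1].
- move=> t u _ [->|Zu] /=.
    by rewrite !clamp_eq0 ?i1 ?i2 ?lexx ?ler01//; first [by left | lra].
  by rewrite i1//; [rewrite i2//; right|right].
- by move=> t _; apply: homeomorphism_comp; [exact: h1|exact: h2].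
- move=> u s t s0 st t1 /=.
  have /andP[a0 a1] := cl1 s; have /andP[b0 b1] := cl1 t.
  have /andP[a0' a1'] := cl2 s; have /andP[b0' b1'] := cl2 t.
  (* If [s] is in the first half, [eta2] is still the identity at time [s], and the comparison
     passes through [eta1] at the clamped time of [t]. *)
  have [sh|sh] := leP s (1 / 2).
    rewrite [clamp (2 * s - 1)]clamp_eq0; last by lra.
    rewrite [eta2 0 _]i2 ?lexx ?ler01//; last by left.
    apply: (@le_trans _ _ (J (eta1 (clamp (2 * t)) u))).
      rewrite -[leRHS](congr1 J (i2 0 (eta1 (clamp (2 * t)) u) _ _)) ?lexx ?ler01//; last by left.
      exact: m2.
    by apply: m1 => //; apply: clamp_le; lra.
  rewrite [clamp (2 * s)]clamp_eq1 1?[clamp (2 * t)]clamp_eq1; try lra.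
  by apply: m2 => //; apply: clamp_le; lra.
- move=> t u _ /=; have [p11 p12 p13] := p1 _ u (cl1 t).
  have [p21 p22 p23] := p2 _ (eta1 (clamp (2 * t)) u) (cl2 t).
  split; [by move=> /p11/p21|by move=> /p12/p22|].
  by move=> e; rewrite p13// p23.
Qed.

(** The composition of the varying maps [F k] is expressed through orbits; [eta] is chosen before
    the orbit. *)
Lemma deformation_iter (F : nat -> X -> X) :
  (forall n, exists2 eta, deformation eta & eta 1 = F n) ->
  forall n, exists2 eta, deformation eta &
    forall u : nat -> X, (forall k, u k.+1 = F k (u k)) -> eta 1 (u 0) = u n.
Proof.
move=> hF; elim=> [|n [eta1 def1 IH]].
  by exists (fun _ u => u) => //; exact: deformation_id.
have [eta2 def2 e2] := hF n.
have [eta def e] := deformation_concat def1 def2.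
by exists eta => // u hu; rewrite e /= e2 IH.
Qed.

Lemma push_deformation (g : X -> X) :
  (forall x y, `|g x - g y| <= 1 / 2 * `|x - y|) ->
  (forall u, ~ Z u -> g u = 0) ->
  (forall u s t, 0 <= s -> s <= t -> t <= 1 -> J (u + t *: g u) <= J (u + s *: g u)) ->
  (forall t u, 0 <= t <= 1 -> D1 u -> D1 (u + t *: g u)) ->
  (forall t u, 0 <= t <= 1 -> D2 u -> D2 (u + t *: g u)) ->
  (ev -> forall u, g (- u) = - g u) ->
  deformation (fun t u => u + t *: g u).
Proof.
move=> glip gZ gJ g1 g2 godd.
have gc : continuous g by exact: lipschitz_continuous glip.
split=> //.
- move=> [t u]; apply: cvgD; first exact: cvg_snd.
  apply: cvgZ; first exact: cvg_fst.
  apply: (@continuous_comp _ _ _ (fun tu : R * X => tu.2) g); last exact: gc.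
  exact: cvg_snd.
- by move=> t u _ [->|/gZ->]; rewrite ?scale0r ?scaler0 addr0.
- move=> t /andP[t0 t1].
  apply: (@lipschitz_perturbation_homeomorphism (fun x => t *: g x)) => x y.
  rewrite -scalerBr normrZ ger0_norm// (le_trans _ (glip x y))//.
  by rewrite ler_piMl.
- move=> t u t01; split; [exact: g1|exact: g2|].
  by move=> e; rewrite (godd e) scalerN opprD.
Qed.

End Deformation.

(** * Symmetry of critical points and local descent respecting both neighbourhoods *)

Section Pushes.
Context {R : realType} {X : normedModType R}.
Variable J : X -> R^o.
Hypothesis lipJ : locally_lipschitz J.

(** Evenness turns descent at [- x] along [v] into descent at [x] along [- v], which a zero
    subgradient at [x] excludes. *)
Lemma even_critical r x : (forall u, J (- u) = J u) ->
  critical_level J r x -> critical_level J r (- x).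
Proof.
move=> evJ [x0 xr]; split; last by rewrite evJ.
apply: slope_eq0 => //.
have Jx := critical_subdifferential lipJ x0.
apply: dual_subdifferentialP => //; first by case: Jx => -[].
move=> v; suff : 0 <= clarke J (- x) v by [].
rewrite leNgt; apply/negP => xv.
have [d d0 hd] : exists2 d : R, 0 < d & forall z t, `|z - - x| < d ->
    0 < t < d -> J (z + t *: v) - J z <= clarke J (- x) v / 2 * t.
  by apply: clarke_quotient => //; lra.
have : clarke J x (- v) <= clarke J (- x) v / 2.
  apply: (clarke_le lipJ d0) => z t zx td.
  have := hd (- z) t; rewrite -opprD normrN => /(_ zx td).
  by rewrite evJ -[J (z + _)]evJ opprD scalerN opprK.
have : 0 <= clarke J x (- v) by exact: (subdifferential_le lipJ (- v) Jx).
lra.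
Qed.

Lemma good_direction P mu a :
  reflexive_space X -> is_cone P -> 0 < mu ->
  id_sub_gradient_maps J (boundary (Dpos P mu)) (Dpos P (1 / 2 * mu)) ->
  id_sub_gradient_maps J (boundary (Dneg P mu)) (Dneg P (1 / 2 * mu)) ->
  ~ (Dpos P mu)° a -> ~ (Dneg P mu)° a -> 0 < slope J a ->
  exists2 rho : R, 0 < rho & exists2 v : X, `|v| = 1 &
    forall z t, `|z - a| < rho -> 0 <= t <= rho ->
      [/\ J (z + t *: v) <= J z - t * (slope J a / 2),
          Dpos P mu z -> Dpos P mu (z + t *: v) &
          Dneg P mu z -> Dneg P mu (z + t *: v)].
Proof.
move=> refl coneP mu0 gradp gradm aDp aDm sa.
have muE : 1 / 2 * mu = mu / 2 by lra.
rewrite muE in gradp gradm.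
have convp := is_cone_convex coneP; have convm := convex_opp convp.
(* Condition (a) says that minus a duality image of a subgradient lies in [C]; away from the
   boundaries [C] imposes nothing. *)
pose C := [set v | (boundary (Dpos P mu) a -> Dpos P (mu / 2) (a + v)) /\
                   (boundary (Dneg P mu) a -> Dneg P (mu / 2) (a + v))].
have addE v w t : a + (t *: v + (1 - t) *: w) = t *: (a + v) + (1 - t) *: (a + w).
  by rewrite !scalerDr addrACA -scalerDl [t + _]addrC subrK scale1r.
have [||v [vp vm] cv] := @descent_direction _ _ _ lipJ a C refl sa.
- move=> v w t t01 [vp vm] [wp wm]; split=> ba; rewrite addE.
    by apply: convex_closed_nbhd => //; [exact: vp|exact: wp].
  by apply: convex_closed_nbhd => //; [exact: vm|exact: wm].
- by move=> y ay; split=> ba; [exact: gradp|exact: gradm].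
have sp := clarke_sublinear lipJ a.
have v0 : 0 < `|v|.
  rewrite normr_gt0; apply/eqP => v0; move: cv.
  by rewrite v0 normr0 mulr0 oppr0 sublinear0// ltxx.
have ce : clarke J a (`|v|^-1 *: v) < - (slope J a / 2).
  rewrite (sublinearZ _ sp) ?invr_ge0// mulrC ltr_pdivrMr// mulNr.
  exact: cv.
have [d d0 hd] := clarke_quotient lipJ ce.
have [r1 r10 h1] := inward_ball convp mu0 vp aDp v0.
have [r2 r20 h2] := inward_ball convm mu0 vm aDm v0.
exists (Num.min (d / 2) (Num.min r1 r2)).
  by rewrite !lt_min r10 r20 divr_gt0.
exists (`|v|^-1 *: v); first by rewrite normrZ normfV normr_id mulVf ?gt_eqF.
move=> z t; rewrite !lt_min !le_min => /and3P[zd z1 z2] /and4P[t0 td t1 t2].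
split; [|by apply: h1; rewrite ?t0|by apply: h2; rewrite ?t0].
move: t0; rewrite le_eqVlt => /orP[/eqP<-|t0].
  by rewrite scale0r addr0 mul0r subr0.
have zd' : `|z - a| < d by lra.
have td' : 0 < t < d by rewrite t0 /=; lra.
by have := hd z t zd' td'; lra.
Qed.

End Pushes.

Lemma homeomorphism_interior (R : realType) (X : normedModType R)
    (f : X -> X) (D : set X) :
  homeomorphism f -> (forall x, D x -> D (f x)) -> forall x, D° x -> D° (f x).
Proof.
move=> [g [fK gK _ cg]] fD x Dx.
have : nbhs (f x) (g @^-1` D) by apply: cg; rewrite fK.
by apply: filterS => y /= /fD; rewrite gK.
Qed.

(** Odd multiples of [2 ^ n] show that [logn 2 j.+1] takes each value for arbitrarily large [j];
    this is the schedule by which every push recurs. *)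
Lemma logn2_frequent (n N : nat) : exists2 j, (N <= j)%N & logn 2 j.+1 = n.
Proof.
exists (2 ^ n * (2 * N).+1).-1.
  rewrite -ltnS prednK ?muln_gt0 ?expn_gt0//.
  by rewrite (leq_trans _ (leq_pmull _ _)) ?expn_gt0// ltnS leq_pmull.
rewrite prednK ?muln_gt0 ?expn_gt0// lognM ?expn_gt0// pfactorK//.
rewrite (_ : logn 2 (2 * N).+1 = 0%N) ?addn0//.
by rewrite lognE dvdn2 /= mul2n odd_double.
Qed.

(** * Discrete descent sequences whose steps are controlled by the drop of [J] *)

Section Trajectory.
Context {R : realType} {X : completeNormedModType R}.
Variables (J : X -> R^o) (c : R) (u : nat -> X).
Hypothesis c0 : 0 < c.
Hypothesis u_step : forall j,
  `|u j.+1 - u j| <= c * (1 + `|u j|) * (J (u j) - J (u j.+1)).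

Let J_step j : J (u j.+1) <= J (u j).
Proof.
have n0 : 0 < c * (1 + `|u j|) by rewrite mulr_gt0// ltr_pwDl.
by rewrite -subr_ge0 -(pmulr_rge0 _ n0) (le_trans _ (u_step j)).
Qed.

Lemma descent_le i j : (i <= j)%N -> J (u j) <= J (u i).
Proof.
move=> /subnK <-; elim: (j - i)%N => // k IH.
by rewrite addSn (le_trans (J_step _)).
Qed.

(** A discrete Gronwall estimate, from [1 + x <= expR x] at each step. *)
Lemma descent_norm_le j :
  1 + `|u j| <= (1 + `|u 0|) * expR (c * (J (u 0) - J (u j))).
Proof.
elim: j => [|j IH]; first by rewrite subrr mulr0 expR0 mulr1.
have -> : c * (J (u 0) - J (u j.+1)) =
    c * (J (u 0) - J (u j)) + c * (J (u j) - J (u j.+1)) by ring.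
rewrite expRD mulrA; apply: le_trans (ler_wpM2r (expR_ge0 _) IH).
have n0 : 0 <= 1 + `|u j| by rewrite addr_ge0.
apply: (@le_trans _ _ ((1 + `|u j|) * (1 + c * (J (u j) - J (u j.+1))))).
  have := u_step j; have := ler_normD (u j.+1 - u j) (u j); rewrite subrK; lra.
by rewrite ler_wpM2l// expR_ge1Dx.
Qed.

(** A lower bound on [J] bounds the norms; distances are then at most a constant times a drop of
    [J], so the sequence is Cauchy. *)
Lemma descent_cvg b : (forall j, b <= J (u j)) -> cvgn u.
Proof.
move=> ub.
have N0 : 0 < 1 + `|u 0| by rewrite ltr_pwDl.
have [N Np uN] : exists2 N : R, 0 < N & forall j, 1 + `|u j| <= N.
  exists ((1 + `|u 0|) * expR (c * (J (u 0) - b))).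
    by apply: mulr_gt0 => //; exact: expR_gt0.
  move=> j; rewrite (le_trans (descent_norm_le j))// ler_pM2l// ler_expR ler_pM2l//.
  by rewrite lerB.
have dist i j : (i <= j)%N -> `|u j - u i| <= c * N * (J (u i) - J (u j)).
  move=> /subnK <-; elim: (j - i)%N => [|k IH].
    by rewrite add0n !subrr normr0 mulr0.
  have step : `|u (k + i).+1 - u (k + i)| <=
      c * N * (J (u (k + i)) - J (u (k + i).+1)).
    rewrite (le_trans (u_step _))// ler_wpM2r ?subr_ge0// ler_pM2l//.
  have := ler_normD (u (k + i).+1 - u (k + i)) (u (k + i) - u i).
  by rewrite addSn addrA subrK; lra.
have cJ : cvgn (fun j => J (u j) : R).
  apply: nonincreasing_is_cvgn; first by move=> i j ij; exact: descent_le.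
  by exists b => _ [j _ <-].
apply/cauchy_cvgP/cauchy_exP => e e0.
have e1 : 0 < e / (c * N) by rewrite divr_gt0// mulr_gt0.
have [l lJ] : exists l : R, J (u j) @[j --> \oo] --> l.
  by exists (limn (fun j => J (u j) : R)).
have l_le j : l <= J (u j).
  have <- : limn (fun j => J (u j) : R) = l by apply/cvg_lim.
  apply: limr_le => //; near=> k; apply: descent_le; near: k.
  by exists j.
have [j _ hj] : \forall j \near \oo, `|l - J (u j)| < e / (c * N).
  by move/cvgrPdist_lt : lJ; apply.
exists (u j); exists j => // i /= ji; rewrite -ball_normE /= distrC.
rewrite (le_lt_trans (dist _ _ ji))// mulrC -ltr_pdivlMr ?mulr_gt0//.
have := hj j (leqnn j); rewrite distrC => /(le_lt_trans (ler_norm _)).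
have := l_le i; lra.
Unshelve. all: by end_near. Qed.

(** From distance [4 * d] or more, one step of length at most [d] stays beyond [3 * d]. Closer to
    [k] the norm is under control, and any approach is paid for by a drop of [J]. *)
Lemma descent_avoids k (d B : R) : (forall j, `|u j.+1 - u j| <= d) ->
  1 + `|k| + 4 * d <= B -> 0 < d -> 3 * d <= `|u 0 - k| ->
  forall j, 3 * d - c * B * (J (u 0) - J (u j)) <= `|u j - k|.
Proof.
move=> ud kB d0 u0; have B0 : 0 <= B.
  by rewrite (le_trans _ kB)// !addr_ge0// mulr_ge0// ltW.
have cB : 0 <= c * B by rewrite mulr_ge0// ltW.
elim=> [|j IH]; first by rewrite subrr mulr0 subr0.
have tri := ler_normD (u j - u j.+1) (u j.+1 - k).
rewrite addrA subrK [ `|u j - _| ]distrC in tri.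
have Jj := J_step j; have J0j := descent_le (leq0n j).
have [far|near_k] := leP (4 * d) `|u j - k|.
  have := ud j; have : 0 <= c * B * (J (u 0) - J (u j.+1)).
    by rewrite mulr_ge0// subr_ge0 descent_le.
  lra.
have := u_step j.
have : c * (1 + `|u j|) * (J (u j) - J (u j.+1)) <= c * B * (J (u j) - J (u j.+1)).
  rewrite ler_wpM2r ?subr_ge0// ler_pM2l//.
  have := ler_normD (u j - k) k; rewrite subrK; lra.
lra.
Qed.

End Trajectory.

(** * Closedness and compactness facts, and the countable family of pushes *)

Lemma closed_far (R : realType) (X : normedModType R) (K : set X) (c : R) :
  closed [set x | forall k, K k -> c <= `|x - k|].
Proof.
move=> x xK k Kk; rewrite leNgt; apply/negP => xk.
have xk0 : 0 < c - `|x - k| by rewrite subr_gt0.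
have [y [/(_ k Kk) yk]] := xK _ (nbhsx_ballx x _ xk0).
rewrite -ball_normE /= => xy.
by have := ler_normD (y - x) (x - k); rewrite addrA subrK [ `|y - x| ]distrC; lra.
Qed.

(** At a critical point [0] is a set gradient, so on the boundary condition (a) would put [x - 0] in
    the smaller neighbourhood, hence in the interior. *)
Lemma critical_interior (R : realType) (X : normedModType R) (J : X -> R^o)
    (Q : set X) (mu : R) x :
  locally_lipschitz J -> 0 < mu ->
  id_sub_gradient_maps J (boundary (closed_nbhd Q mu)) (closed_nbhd Q (1 / 2 * mu)) ->
  slope J x = 0 -> closed_nbhd Q mu x -> (closed_nbhd Q mu)° x.
Proof.
move=> lipJ mu0 grad x0 Qx; apply: contrapT => nQx.
apply: (nQx); apply: (@closed_nbhd_interior _ _ _ (1 / 2 * mu)); first by lra.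
rewrite -[x]subr0; apply: grad; first by split => //; exact: subset_closure.
exists 0; first exact: critical_subdifferential.
have n0 : dual_norm (0 : X -> R^o) = 0.
  have := @dual_norm_le _ X 0 0 (lexx _); have := @dual_norm_ge0 _ X 0.
  move=> h1 h2; apply/eqP; rewrite eq_le h1 ?h2//.
    by move=> y; rewrite normr0 mul0r.
  by case: (critical_subdifferential lipJ x0).
by rewrite /duality_map /= n0 normr0 expr0n.
Qed.

(** Points of [A] missing [O] at every stage would cluster at some [x] in [A]; once [x] has reached
    [O], so have its neighbours, and [O] is never left. *)
Lemma compact_reach (T Y : topologicalType) (A : set T) (f : nat -> T -> Y)
    (O : set Y) :
  compact A -> open O -> (forall j, continuous (f j)) ->
  (forall j x, O (f j x) -> O (f j.+1 x)) ->
  (forall x, A x -> exists j, O (f j x)) ->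
  exists j, forall x, A x -> O (f j x).
Proof.
move=> cA oO cf fS fA; apply: contrapT => nex.
have /choice[u hu] j : exists x, A x /\ ~ O (f j x).
  apply: contrapT => nx; apply: nex; exists j => x Ax.
  by apply: contrapT => h; apply: nx; exists x.
have fle i j x : (i <= j)%N -> O (f i x) -> O (f j x).
  by move=> /subnK <- h; elim: (j - i)%N => // k IH; rewrite addSn; exact: fS.
have PF : ProperFilter (u @ \oo) by exact: fmap_proper_filter.
have [|x [Ax xcl]] := cA (u @ \oo) PF.
  by exists 0%N => // j _; have [] := hu j.
have [j Oj] := fA x Ax.
have uj : (u @ \oo) [set u i | i in [set i | (j <= i)%N]].
  by exists j => // i /= ji; exists i.
have xO : nbhs x (f j @^-1` O).
  exact: (cf j x _ (open_nbhs_nbhs (conj oO Oj))).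
have [y [[i /= ji <-] Oi]] := xcl _ _ uj xO.
by have [_] := hu i; apply; exact: fle ji Oi.
Qed.

Lemma descent_pushes (R : realType) (X : normedModType R) (J : X -> R)
    (Z D1 D2 W : set X) (ev : Prop) (c d : R) :
  0 < d ->
  (forall a, W a -> exists p : R * X,
    [/\ 0 < p.1 <= `|a|, `|p.2| = 1, (forall z, `|z - a| < p.1 -> Z z) &
      forall z t, `|z - a| < p.1 -> `|z + t *: p.2 - a| < p.1 -> 0 <= t ->
        [/\ J (z + t *: p.2) <= J z - t / (c * (1 + `|z|)),
            D1 z -> D1 (z + t *: p.2) & D2 z -> D2 (z + t *: p.2)]]) ->
  (ev -> [/\ forall z, J (- z) = J z, forall z, Z z -> Z (- z),
    forall z, D1 z -> D2 (- z) & forall z, D2 z -> D1 (- z)]) ->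
  exists g : nat -> X -> X,
    [/\ (forall n x y, `|g n x - g n y| <= 1 / 2 * `|x - y|),
        (forall n x, g n x != 0 -> Z x) /\ (forall n x, `|g n x| <= d),
        (forall x, W x -> exists n, g n x != 0),
        (forall n x s t, 0 <= s -> s <= t -> t <= 1 ->
          J (x + t *: g n x) <=
          J (x + s *: g n x) - (t - s) * `|g n x| / (c * (1 + `|x + s *: g n x|))) &
        (forall n x, [/\ forall t, 0 <= t <= 1 -> D1 x -> D1 (x + t *: g n x),
          forall t, 0 <= t <= 1 -> D2 x -> D2 (x + t *: g n x) &
          ev -> g n (- x) = - g n x])].
Proof.
move=> d0 good sym.
have /choice[p hp] a : exists p : R * X, W a ->
    [/\ 0 < p.1 <= `|a|, `|p.2| = 1, (forall z, `|z - a| < p.1 -> Z z) &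
      forall z t, `|z - a| < p.1 -> `|z + t *: p.2 - a| < p.1 -> 0 <= t ->
        [/\ J (z + t *: p.2) <= J z - t / (c * (1 + `|z|)),
            D1 z -> D1 (z + t *: p.2) & D2 z -> D2 (z + t *: p.2)]].
  have [Wa|nWa] := pselect (W a); last by exists (0, 0).
  by have [q hq] := good a Wa; exists q.
pose rho a := (p a).1; pose v a := (p a).2.
have rhoW a : W a -> 0 < rho a <= `|a| by move=> /hp[].
have normv a : W a -> `|v a| = 1 by move=> /hp[].
have cellZ a s z : W a -> cell_sign ev s -> cell rho a s z -> Z z.
  move=> Wa [->|[e ->]]; have [_ _ hZ _] := hp a Wa; rewrite /cell /=.
    by rewrite scale1r; exact: hZ.
  have [_ Zs _ _] := sym e; rewrite scaleN1r opprK => za.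
  by rewrite -[z]opprK; apply/Zs/hZ; rewrite -opprD normrN.
(* In a mirrored cell the estimate is applied at [- z]; the symmetry exchanges [D1] and [D2]. *)
have cell_good a s z t : W a -> cell_sign ev s -> cell rho a s z ->
    cell rho a s (z + t *: (s *: v a)) -> 0 <= t ->
    [/\ J (z + t *: (s *: v a)) <= J z - t / (c * (1 + `|z|)),
        D1 z -> D1 (z + t *: (s *: v a)) & D2 z -> D2 (z + t *: (s *: v a))].
  move=> Wa [->|[e ->]]; have [_ _ _ hG] := hp a Wa; rewrite /cell /=.
    by rewrite !scale1r; exact: hG.
  have [evJ _ D12 D21] := sym e; rewrite !scaleN1r !opprK => za zta t0.
  have [||h1 h2 h3] := hG (- z) t _ _ t0.
  - by rewrite -opprD normrN.
  - by rewrite -normrN !opprD !opprK -scalerN.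
  have zE : z + t *: - v a = - (- z + t *: v a) by rewrite opprD opprK scalerN.
  rewrite zE evJ; split; first by move: h1; rewrite evJ normrN.
    by move=> /D12/h3/D21.
  by move=> /D21/h2/D12.
have [g [glip gcell gW godd]] := separated_push ev rhoW normv.
(* These scales tend to zero, so at each point of [W] some push is nonzero. *)
pose tau n : R := d / n.+1%:R.
have tau0 n : 0 < tau n by rewrite divr_gt0.
have taud n : tau n <= d by rewrite ler_pdivrMr// ler_peMr ?ler1n ?ltW.
(* The factor lowers the Lipschitz constant from 2 to 1/2, and the whole segment from [x] to
   [x + h n x] remains in one cell. *)
pose h n x := (1 / 4) *: g (tau n) x.
have hcell n x : h n x != 0 -> exists a s T, [/\ W a, cell_sign ev s, 0 < T,
    h n x = T *: (s *: v a) & [/\ `|h n x| = T, T <= tau n / 4 &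
    forall t, 0 <= t <= 1 -> cell rho a s (x + t *: h n x)]].
  rewrite /h scaler_eq0 negb_or => /andP[_ /(gcell _ _ (tau0 n))].
  move=> [t [a [s [/andP[t0 tt] Wa ss -> hc]]]].
  have nE : `|(1 / 4) *: (t *: (s *: v a))| = t / 4.
    rewrite !normrZ (cell_sign_norm ss) (normv _ Wa) !gtr0_norm//; lra.
  exists a, s, (1 / 4 * t); split=> //; first by lra.
    by rewrite !scalerA.
  split=> [||u /andP[u0 u1]]; [by rewrite nE; lra|by lra|].
  apply: hc; rewrite [x + _]addrC addrK normrZ nE ger0_norm//.
  rewrite (@le_lt_trans _ _ (t / 4))//; last by have := tau0 n; lra.
  by rewrite ler_piMl// divr_ge0// ltW.
have line n x s t : 0 <= s -> s <= t -> t <= 1 ->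
    [/\ J (x + t *: h n x) <=
        J (x + s *: h n x) - (t - s) * `|h n x| / (c * (1 + `|x + s *: h n x|)),
        D1 (x + s *: h n x) -> D1 (x + t *: h n x) &
        D2 (x + s *: h n x) -> D2 (x + t *: h n x)].
  move=> s0 st t1; have [->|hx] := eqVneq (h n x) 0.
    by rewrite !scaler0 normr0 mulr0 mul0r subr0.
  have [a [z [T [Wa sz T0 hE [nE _ hc]]]]] := hcell n x hx.
  have tE : x + t *: h n x = (x + s *: h n x) + ((t - s) * T) *: (z *: v a).
    by rewrite -scalerA -hE -addrA -scalerDl [s + _]addrC subrK.
  have cs : cell rho a z (x + s *: h n x) by apply: hc; rewrite s0 /=; lra.
  have ct : cell rho a z (x + s *: h n x + ((t - s) * T) *: (z *: v a)).
    by rewrite -tE; apply: hc; rewrite t1 andbT; lra.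
  rewrite tE nE; apply: cell_good => //.
  by rewrite mulr_ge0 ?subr_ge0// ltW.
exists h; split.
- move=> n x y; rewrite -scalerBr normrZ gtr0_norm; last by lra.
  by have := glip (tau n) x y (tau0 n); lra.
- split=> n x.
    move=> /hcell[a [s [T [Wa ss _ _ [_ _ /(_ 0)]]]]].
    by rewrite lexx ler01 scale0r addr0 => /(_ isT)/(cellZ _ _ _ Wa ss).
  have [->|hx] := eqVneq (h n x) 0; first by rewrite normr0 ltW.
  have [a [s [T [_ _ T0 _ [-> TT _]]]]] := hcell n x hx.
  by have := taud n; have := tau0 n; lra.
- move=> x /gW[e e0 he]; near \oo => n; exists n.
  rewrite scaler_eq0 negb_or; apply/andP; split; first by apply/eqP; lra.
  apply: he; rewrite tau0 /= /tau mulrC -ltr_pdivlMr//.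
  by near: n; exact: near_infty_natSinv_lt (PosNum (divr_gt0 e0 d0)).
- by move=> n x s t s0 st t1; have [] := line n x s t s0 st t1.
- move=> n x; split=> [t /andP[t0 t1]|t /andP[t0 t1]|e].
  + by have [_ + _] := line n x 0 t (lexx _) t0 t1; rewrite scale0r addr0.
  + by have [_ _] := line n x 0 t (lexx _) t0 t1; rewrite scale0r addr0.
  + by rewrite /h godd// scalerN.
Unshelve. all: by end_near. Qed.

(** * Assembly of the pushes into a deformation near level [r] *)

Theorem lemma3p4 (R : realType) (X : completeNormedModType R)
    (P : set X) (J : X -> R^o) (mu0 : R) :
  reflexive_space X -> is_cone P -> locally_lipschitz J -> 0 < mu0 < 1 ->
  let Dp := Dpos P mu0 in
  let Dm := Dneg P mu0 in
  id_sub_gradient_maps J (boundary Dp) (Dpos P (1 / 2 * mu0)) ->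
  id_sub_gradient_maps J (boundary Dm) (Dneg P (1 / 2 * mu0)) ->
  C_condition J setT setT ->
  C_condition J (Dpos P (3 / 4 * mu0)) Dp ->
  C_condition J (Dneg P (3 / 4 * mu0)) Dm ->
  C_condition J (Dp `&` Dm) (Dp `&` Dm) ->
  forall (r : R),
  let K1 := critical_level J r `&` (Dp `|` Dm) in
  let K2 := critical_level J r `\` (Dp `|` Dm) in
  forall (delta : R), 0 < delta ->
  open_nbhd K1 (3 * delta) `&` open_nbhd K2 (3 * delta) = set0 ->
  forall eps0 : R, 0 < eps0 ->
  exists2 epsbar : R, 0 < epsbar < eps0 &
  forall eps : R, 0 < eps < epsbar ->
  forall A : set X, compact A -> A `<=` sublevel J (r + eps) ->
  exists2 eta : R -> X -> X,
    {within `[0, 1] `*` setT,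
      continuous (fun tu : R * X => eta tu.1 tu.2)} &
    [/\ (forall t u, t \in `[0, 1] ->
           t = 0 \/ ~ (J @^-1` `[r - eps0, r + eps0] `\` open_nbhd K2 delta) u ->
           eta t u = u),
        (eta 1 @` (A `\` open_nbhd K2 (3 * delta))
           `<=` sublevel J (r - eps) `|` Dp° `|` Dm°) /\
        (K2 = set0 -> eta 1 @` A `<=` sublevel J (r - eps) `|` Dp° `|` Dm°),
        (forall t, t \in `[0, 1] -> homeomorphism (eta t)),
        (forall u s t, 0 <= s -> s <= t -> t <= 1 ->
           J (eta t u) <= J (eta s u)) &
        (forall t, t \in `[0, 1] ->
           [/\ eta t @` Dp `<=` Dp, eta t @` Dm `<=` Dm &
               eta t @` (Dp `&` Dm) `<=` Dp `&` Dm]) /\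
        ((forall u, J (- u) = J u) ->
           forall t u, t \in `[0, 1] -> eta t (- u) = - eta t u)].
Proof.
move=> refl coneP lipJ /andP[mu0_gt0 _] Dp Dm gradp gradm condC _ _ _ r K1 K2.
move=> d d0 _ eps0 eps0_gt0.
pose ev := forall u, J (- u) = J u.
(* The distance [2 * d] lies between [d], where the pushes must vanish, and [3 * d], where the
   orbits start. *)
pose G := (~` Dp° `&` ~` Dm°) `&`
          [set x | forall k, K2 k -> 2 * d <= `|x - k|].
have cG : closed G.
  apply: closedI; last exact: closed_far.
  by apply: closedI; rewrite closedC; exact: open_interior.
have G_crit x : G x -> ~ critical_level J r x.
  move=> [[nDp nDm] far] [x0 xr].
  have [|nD] := pselect ((Dp `|` Dm) x).
    by case=> [/(critical_interior lipJ mu0_gt0 gradp x0)|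
               /(critical_interior lipJ mu0_gt0 gradm x0)].
  have /far : K2 x by split.
  by rewrite subrr normr0; lra.
have [e1 e10 [s s0 slope_s]] := slope_lower_bound lipJ condC cG G_crit.
have [M KM] := critical_level_bounded lipJ condC r.
have Jc : continuous (J : X -> R) := locally_lipschitz_continuous lipJ.
pose e2 := Num.min e1 eps0.
have e20 : 0 < e2 by rewrite lt_min e10.
pose W := G `&` [set x | `|J x - r| < e2].
pose Z := [set x | r - eps0 <= J x <= r + eps0 /\ forall k, K2 k -> d <= `|x - k|].
(* The constant in the descent rate: [slope J a / 2] is at least [s / (2 * (1 + |a|))], and passing
   from [a] to a nearby [z] costs another factor 2. *)
have s4 : 0 < 4 / s by rewrite divr_gt0.
(* The origin is interior to both neighbourhoods, so centres of cells are nonzero, as [rho a <= |a|]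
   demands. *)
have D0 (Q : set X) : Q 0 -> (closed_nbhd Q mu0)° 0.
  move=> Q0; apply: (@closed_nbhd_interior _ _ _ 0) => //.
  exact: (sub_closed_nbhd (lexx _)).
have good a : W a -> exists p : R * X,
    [/\ 0 < p.1 <= `|a|, `|p.2| = 1, (forall z, `|z - a| < p.1 -> Z z) &
      forall z t, `|z - a| < p.1 -> `|z + t *: p.2 - a| < p.1 -> 0 <= t ->
        [/\ J (z + t *: p.2) <= J z - t / (4 / s * (1 + `|z|)),
            Dp z -> Dp (z + t *: p.2) & Dm z -> Dm (z + t *: p.2)]].
  move=> [Ga Ja]; have [[nDp nDm] far] := Ga.
  have a0 : 0 < `|a|.
    rewrite normr_gt0; apply/eqP => a0; apply: nDp; rewrite a0.
    exact: (D0 P (is_cone0 coneP)).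
  have na : 0 < 1 + `|a| by rewrite ltr_pwDl.
  have sa : s <= (1 + `|a|) * slope J a.
    by apply: slope_s => //; rewrite (lt_le_trans Ja)// ge_min lexx.
  have sa0 : 0 < slope J a by rewrite -(pmulr_rgt0 _ na) (lt_le_trans s0).
  have [rho1 rho10 [v v1 hv]] :=
    good_direction lipJ refl coneP mu0_gt0 gradp gradm nDp nDm sa0.
  have /nbhs_ballP[rho2 /= rho20 J2] : \forall z \near a, `|J z - r| < eps0.
    have Jae : `|J a - r| < eps0 by rewrite (lt_le_trans Ja)// ge_min lexx orbT.
    have ee : 0 < eps0 - `|J a - r| by rewrite subr_gt0.
    have /cvgrPdist_lt/(_ _ ee) := Jc a; apply: filterS => z.
    have := ler_normD (J z - J a) (J a - r).
    by rewrite addrA subrK [ `|J z - J a| ]distrC; lra.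
  (* In order: times stay below [rho1]; [J] stays within [eps0] of [r]; [1 + |a| <= 2 * (1 + |z|)];
     [z] keeps distance [d] from [K2]; cells miss their mirror images. *)
  exists (Num.min (rho1 / 2) (Num.min rho2 (Num.min 1 (Num.min d `|a|))), v) => /=.
  split=> //.
  - rewrite !lt_min rho20 ltr01 d0 a0 divr_gt0//=.
    by rewrite !ge_min lexx !orbT.
  - move=> z; rewrite !lt_min => /and5P[_ za2 _ zad _]; split.
      have := J2 z; rewrite -ball_normE /= distrC => /(_ za2).
      by rewrite ltr_norml; lra.
    move=> k /far; have := ler_normD (a - z) (z - k).
    by rewrite addrA subrK [ `|a - z| ]distrC; lra.
  - move=> z t; rewrite !lt_min => /and5P[za1 _ za3 _ _] /and5P[zta _ _ _ _] t0.
    have tlt : t <= rho1.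
      have := ler_normB (z + t *: v - a) (z - a).
      rewrite opprB addrA subrK addrAC subrr add0r normrZ v1 mulr1 ger0_norm//; lra.
    have [||h1 h2 h3] := hv z t; [by lra|by rewrite t0|].
    split=> //; apply: le_trans h1 _; rewrite lerB// ler_wpM2l//.
    have nz : 0 < 1 + `|z| by rewrite ltr_pwDl.
    rewrite invfM invf_div -[leLHS]/(s / 4 / (1 + `|z|)) ler_pdivrMr//.
    have : (1 + `|a|) * slope J a <= 2 * (1 + `|z|) * slope J a.
      rewrite ler_pM2r//; have := ler_normB z (z - a).
      by rewrite opprB addrC subrK; have := normr_ge0 z; lra.
    by lra.
have DpN z : Dp z -> Dm (- z) by move=> /closed_nbhd_opp.
have DmN z : Dm z -> Dp (- z) by rewrite -{1}[z]opprK => /closed_nbhd_opp.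
have K2N k : ev -> K2 k -> K2 (- k).
  move=> e [kr kD]; split; first exact: even_critical.
  case=> [/DpN|/DmN] h; apply: kD; rewrite -[k]opprK; first by right.
  by left.
have sym : ev -> [/\ forall z, J (- z) = J z, forall z, Z z -> Z (- z),
    forall z, Dp z -> Dm (- z) & forall z, Dm z -> Dp (- z)].
  move=> e; split=> // z [zr zk]; split; first by rewrite e.
  by move=> k /(K2N _ e)/zk; rewrite opprK -normrN opprD.
have [g [glip [gZ gd] gW gJ gD]] := descent_pushes d0 good sym.
pose Y := J @^-1` `[r - eps0, r + eps0] `\` open_nbhd K2 d.
have ZY : Z `<=` Y.
  move=> z [zr zk]; split; first by rewrite /= in_itv.
  by move=> /open_nbhdP[k /zk]; lra.
pose F j u : X := u + g (logn 2 j.+1) u.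
have defF j : exists2 eta, deformation J Y Dp Dm ev eta & eta 1 = F j.
  exists (fun t u => u + t *: g (logn 2 j.+1) u); last first.
    by apply/funext => u; rewrite scale1r.
  apply: push_deformation.
  - exact: glip.
  - move=> u nYu; apply/eqP/negPn/negP => /gZ/ZY; exact: nYu.
  - move=> u s' t s'0 st t1; apply: le_trans (gJ _ _ _ _ s'0 st t1) _.
    rewrite gerBl; apply: divr_ge0; first by rewrite mulr_ge0 ?subr_ge0.
    by apply: mulr_ge0; [exact: ltW|exact: addr_ge0].
  - by move=> t u t01; have [h _ _] := gD (logn 2 j.+1) u; exact: h.
  - by move=> t u t01; have [_ h _] := gD (logn 2 j.+1) u; exact: h.
  - by move=> e u; have [_ _ h] := gD (logn 2 j.+1) u; exact: h.
pose orbit u := fix orbit j := if j is i.+1 then F i (orbit i) else u.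
have orbit_diff u j : orbit u j.+1 - orbit u j = g (logn 2 j.+1) (orbit u j).
  by rewrite /= /F addrAC subrr add0r.
have orbit_step u j : `|orbit u j.+1 - orbit u j| <=
    4 / s * (1 + `|orbit u j|) * (J (orbit u j) - J (orbit u j.+1)).
  have := gJ (logn 2 j.+1) (orbit u j) 0 1 (lexx _) ler01 (lexx _).
  rewrite scale0r addr0 scale1r subr0 mul1r orbit_diff.
  have n0 : 0 < 4 / s * (1 + `|orbit u j|) by rewrite mulr_gt0// ltr_pwDl.
  by rewrite lerBrDr -lerBrDl ler_pdivrMr// mulrC.
(* Boundedness of the critical level makes this constant valid in [descent_avoids] for every [k] in
   [K2]. *)
pose B := 1 + `|M| + 4 * d.
have B0 : 0 < B by rewrite /B -addrA ltr_pwDl// addr_ge0// mulr_ge0// ltW.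
have cB : 0 < 4 / s * B by rewrite mulr_gt0.
(* The second term keeps the levels within the band of [W]; the third makes a drop of [2 * eps] in
   [J] cost less than [d] in distance. *)
exists (Num.min (eps0 / 2) (Num.min (e2 / 2) (d / (4 / s * B) / 2))).
  rewrite !lt_min !divr_gt0//= gt_min; apply/orP; left; lra.
move=> eps /andP[eps_gt0]; rewrite !lt_min => /and3P[eps_eps0 eps_e2 eps_d] A cA AJ.
have {}eps_d : 4 / s * B * (2 * eps) < d.
  by move: eps_d; rewrite -mulrA -invfM ltr_pdivlMr ?mulr_gt0//; lra.
(* The strict inequality makes the target open, as [compact_reach] requires. *)
pose O := [set x | J x < r - eps] `|` Dp° `|` Dm°.
have oO : open O.
  apply: openU; last exact: open_interior.
  apply: openU; last exact: open_interior.
  by have /continuousP/(_ _ (@open_lt R (r - eps))) := Jc.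
have FO j x : O x -> O (F j x).
  have [eta [_ etaI homeo etaJ etaD] <-] := defF j.
  have in01 : 0 <= (1 : R) <= 1 by rewrite lexx ler01.
  have in00 : 0 <= (0 : R) <= 1 by rewrite lexx ler01.
  have eta0 : eta 0 x = x by apply: (etaI _ _ in00); left.
  move=> [[Jx|Dx]|Dx].
  - left; left; apply: le_lt_trans Jx; rewrite -{2}eta0.
    by apply: etaJ.
  - left; right; apply: (homeomorphism_interior (homeo 1 in01)) => // y.
    by have [] := etaD 1 y in01.
  - right; apply: (homeomorphism_interior (homeo 1 in01)) => // y.
    by have [] := etaD 1 y in01.
have exits u : A u -> (forall k, K2 k -> 3 * d <= `|u - k|) ->
    exists j, O (orbit u j).
  move=> Au far_u; apply: contrapT => nO.
  have {nO} nO j : [/\ r - eps <= J (orbit u j), ~ Dp° (orbit u j) & ~ Dm° (orbit u j)].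
    split; first by rewrite leNgt; apply/negP => h; apply: nO; exists j; left; left.
    - by move=> h; apply: nO; exists j; left; right.
    - by move=> h; apply: nO; exists j; right.
  have Jle j : J (orbit u j) <= r + eps.
    exact: le_trans (descent_le s4 (orbit_step u) (leq0n j)) (AJ _ Au).
  (* Starting at distance [3 * d] and losing less than [d], the orbit stays [2 * d] away from
     [K2]. *)
  have far j k : K2 k -> 2 * d <= `|orbit u j - k|.
    move=> Kk.
    have kB : 1 + `|k| + 4 * d <= B.
      by rewrite /B lerD2r lerD2l (le_trans (KM k Kk.1))// ler_norm.
    have ud i : `|orbit u i.+1 - orbit u i| <= d.
      by rewrite orbit_diff.
    apply: le_trans (descent_avoids s4 (orbit_step u) ud kB d0 (far_u k Kk) j).
    have : 4 / s * B * (J (orbit u 0) - J (orbit u j)) <= 4 / s * B * (2 * eps).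
      by rewrite ler_pM2l//; have [] := nO j; have := Jle 0%N; lra.
    by lra.
  have cu : cvgn (orbit u).
    by apply: (descent_cvg s4 (orbit_step u) (b := r - eps)) => j; have [] := nO j.
  set l := limn (orbit u) in cu.
  have Wl : W l.
    split.
      have nG : \forall j \near \oo, G (orbit u j).
        by apply: nearW => j; have [_ nDp nDm] := nO j; split=> // k; exact: far.
      exact: closed_cvg _ cG nG _ cu.
    have cJl : J (orbit u j) @[j --> \oo] --> J l.
      by apply: continuous_cvg; [exact: Jc|exact: cu].
    have h1 : r - eps <= J l.
      have hn : \forall j \near \oo, r - eps <= J (orbit u j).
        by apply: nearW => j; have [] := nO j.
      exact: closed_cvg _ (@closed_ge R (r - eps)) hn _ cJl.
    have h2 : J l <= r + eps.
      have hn : \forall j \near \oo, J (orbit u j) <= r + eps by exact: nearW.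
      exact: closed_cvg _ (@closed_le R (r + eps)) hn _ cJl.
    rewrite /= (@le_lt_trans _ _ eps)//; last by lra.
    by rewrite ler_norml; lra.
  have [n gl] := gW l Wl.
  have nl : 0 < `|g n l| / 4 by rewrite divr_gt0// normr_gt0.
  have [N _ hN] : \forall j \near \oo, `|l - orbit u j| < `|g n l| / 4.
    by move/cvgrPdist_lt : cu; apply.
  (* At such a late [j] the step is exactly [g n (orbit u j)]: small because the orbit converges,
     yet close to the nonzero [g n l]. *)
  have [j Nj jn] := logn2_frequent n N.
  have h1 := hN j Nj; have h2 := hN j.+1 (leqW Nj).
  have := glip n l (orbit u j).
  have := ler_normD (g n l - g n (orbit u j)) (g n (orbit u j)); rewrite subrK.
  have : `|g n (orbit u j)| <= `|l - orbit u j.+1| + `|l - orbit u j|.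
    rewrite [ `|l - orbit u j.+1| ]distrC; apply: le_trans (ler_normD _ _).
    by rewrite addrA subrK orbit_diff jn.
  by lra.
(* Written with distances to points of [K2], the part of [A] off the open neighbourhood is visibly
   closed, hence compact. *)
pose A' := A `&` [set u | forall k, K2 k -> 3 * d <= `|u - k|].
have cA' : compact A' by apply: compact_closedI => //; exact: closed_far.
have orbit_cont j : continuous (fun u => orbit u j).
  elim: j => [|j IH]; first by move=> u; exact: cvg_id.
  move=> u; apply: (@continuous_comp _ _ _ (fun u => orbit u j) (F j)); first exact: IH.
  apply: cvgD; first exact: cvg_id.
  exact: (lipschitz_continuous (glip _)).
have [N hN] : exists j, forall u, A' u -> O (orbit u j).
  apply: (@compact_reach _ _ A' (fun j u => orbit u j) O cA' oO orbit_cont).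
    by move=> j u; exact: FO.
  by move=> u [Au fu]; exact: exits.
have [eta [etac eta_id eta_homeo etaJ etaD] eta1] := deformation_iter defF N.
have eta1E u : eta 1 u = orbit u N by exact: (eta1 (orbit u)).
have reach u : A u -> (forall k, K2 k -> 3 * d <= `|u - k|) ->
    (sublevel J (r - eps) `|` Dp° `|` Dm°) (eta 1 u).
  move=> Au fu; rewrite eta1E; have [[h|h]|h] := hN u (conj Au fu).
  - by left; left; exact: ltW.
  - by left; right.
  - by right.
exists eta; first exact: continuous_subspaceT.
split.
- by move=> t u; rewrite in_itv /= => t01 h; exact: eta_id.
- split=> [_ [u [Au nu] <-]|K20 _ [u Au <-]].
    apply: reach => // k Kk; rewrite leNgt; apply/negP => uk; apply: nu.
    by apply/open_nbhdP; exists k.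
  by apply: reach => // k; rewrite K20.
- by move=> t; rewrite in_itv /=; exact: eta_homeo.
- exact: etaJ.
- split=> [t|e t u]; rewrite in_itv /= => t01.
    split=> [_ [u Du <-]|_ [u Du <-]|_ [u [Du Du'] <-]].
    + by have [h _ _] := etaD t u t01; exact: h.
    + by have [_ h _] := etaD t u t01; exact: h.
    + by have [h h' _] := etaD t u t01; split; [exact: h|exact: h'].
  by have [_ _ h] := etaD t u t01; exact: h.
Qed.
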